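(* Let $n$ and $N$ be positive integers, let $\mathbb{F}\subset\mathbb{C}$ be a field, and let $p_1,\dots,p_n,q_1,\dots,q_n$ be positive integers such that (i) $p_1<\dots<p_n$; (ii) $p_i+q_i=N$ for all $i=1,\dots,n$; (iii) $p_i\neq q_j$ for all $i,j\in\{1,\dots,n\}$ with $i\neq j$; and furthermore $q_i\ge\frac N2$ for all $i=1,\dots,n$. Assume that $f_1,\dots,f_n,g_1,\dots,g_n\colon\mathbb{F}\to\mathbb{C}$ are additive functions, none of them identically zero, satisfying \[ \sum_{i=1}^{n} f_i(x^{p_i})\,g_i(x)^{q_i}=0\qquad\text{for every }x\in\mathbb{F}. \] Then every function $f_i$ and every function $g_i$ ($i=1,\dots,n$), restricted to the multiplicative group $\mathbb{F}^\times$, is a generalized exponential polynomial of degree at most $n-1$.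
   Context: A function $f\colon\mathbb{F}\to\mathbb{C}$ is additive if $f(x+y)=f(x)+f(y)$ for all $x,y\in\mathbb{F}$. For a commutative group $G$ (written multiplicatively), an exponential is a function $m\colon G\to\mathbb{C}$ with $m(xy)=m(x)m(y)$ for all $x,y\in G$. A generalized polynomial of degree at most $r$ on $G$ is a function $p\colon G\to\mathbb{C}$ of the form $p(x)=\sum_{k=0}^{r}A_k(x,\dots,x)$ where each $A_k\colon G^k\to\mathbb{C}$ is symmetric and a homomorphism from $G$ to $(\mathbb{C},+)$ in each variable ($A_0$ is a constant). A generalized exponential polynomial of degree at most $r$ is a finite sum $\sum_j P_j m_j$ where each $m_j$ is an exponential and each $P_j$ is a generalized polynomial of degree at most $r$. *)

(* Defs.v *)
From HB Require Import structures.
From mathcomp Require Import all_boot all_order all_fingroup all_algebra.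
From mathcomp Require Export reals.
From mathcomp Require Export complex.

Set Implicit Arguments.
Unset Strict Implicit.
Unset Printing Implicit Defensive.

Import GRing.Theory.
Local Open Scope ring_scope.

Section MulGroup.
Variable F : fieldType.

(* The library's {unit F} is restricted to finite rings. *)
Definition mul_group := {x : F | x != 0}.

HB.instance Definition _ := SubChoice.copy mul_group {x : F | x != 0}.

Implicit Types x y z : mul_group.

Fact mul_group_mul_subproof x y : val x * val y != 0.
Proof. by rewrite mulf_neq0 ?(valP x) ?(valP y). Qed.

Fact mul_group_inv_subproof x : (val x)^-1 != 0.
Proof. by rewrite invr_eq0 (valP x). Qed.

Definition mul_group_one : mul_group := Sub 1 (oner_neq0 F).
Definition mul_group_mul x y : mul_group :=
  Sub (val x * val y) (mul_group_mul_subproof x y).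
Definition mul_group_inv x : mul_group :=
  Sub (val x)^-1 (mul_group_inv_subproof x).

Fact mul_group_mulA : associative mul_group_mul.
Proof. by move=> x y z; apply: val_inj; rewrite /= mulrA. Qed.

Fact mul_group1r : left_id mul_group_one mul_group_mul.
Proof. by move=> x; apply: val_inj; rewrite /= mul1r. Qed.

Fact mul_groupr1 : right_id mul_group_one mul_group_mul.
Proof. by move=> x; apply: val_inj; rewrite /= mulr1. Qed.

Fact mul_groupVr : left_inverse mul_group_one mul_group_inv mul_group_mul.
Proof. by move=> x; apply: val_inj; rewrite /= mulVf ?(valP x). Qed.

Fact mul_grouprV : right_inverse mul_group_one mul_group_inv mul_group_mul.
Proof. by move=> x; apply: val_inj; rewrite /= divff ?(valP x). Qed.

HB.instance Definition _ := isGroup.Build mul_group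
  mul_group_mulA mul_group1r mul_groupr1 mul_groupVr mul_grouprV.

Lemma val_mul_groupM x y : val (x * y)%g = val x * val y.
Proof. by []. Qed.

Lemma mul_groupC : @commutative mul_group mul_group (fun x y => (x * y)%g).
Proof. by move=> x y; apply: val_inj; rewrite /= mulrC. Qed.

End MulGroup.

Section ExponentialPolynomials.
Variables (G : groupType) (K : comNzRingType).

(* The zero function counts as an exponential. *)
Definition exponential (m : G -> K) : Prop :=
  forall x y : G, m (x * y)%g = m x * m y.

Definition set_coord k (x : {ffun 'I_k -> G}) (i : 'I_k) (a : G) :
    {ffun 'I_k -> G} :=
  [ffun j => if j == i then a else x j].

Definition symmetric_fun k (A : {ffun 'I_k -> G} -> K) : Prop :=
  forall (s : 'S_k) (x : {ffun 'I_k -> G}), A [ffun i => x (s i)] = A x.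

Definition multi_hom k (A : {ffun 'I_k -> G} -> K) : Prop :=
  forall (i : 'I_k) (x : {ffun 'I_k -> G}) (a b : G),
    A (set_coord x i (a * b)%g) = A (set_coord x i a) + A (set_coord x i b).

(* For k = 0 both conditions on A k are vacuous: A 0 is a constant. *)
Definition gen_poly (r : nat) (P : G -> K) : Prop :=
  exists A : forall k : nat, {ffun 'I_k -> G} -> K,
    (forall k, (k <= r)%N -> symmetric_fun (A k) /\ multi_hom (A k)) /\
    forall x : G, P x = \sum_(k < r.+1) A k [ffun=> x].

Definition gen_exp_poly (r : nat) (f : G -> K) : Prop :=
  exists (J : nat) (P m : 'I_J -> G -> K),
    (forall j, gen_poly r (P j) /\ exponential (m j)) /\
    forall x : G, f x = \sum_(j < J) P j x * m j x.

End ExponentialPolynomials.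

(* Main.v *)
From HB Require Import structures.
Require Import Defs.
From mathcomp Require Import all_boot all_order all_algebra.
From mathcomp Require Import finmap boolp reals complex.
From mathcomp Require Import monalg.
From mathcomp Require Import zify ring.

(* Additive functions on F extend to linear functionals on the commutative
   K-algebra B spanned by the elements of F (K = R[i]), and the equation extends
   to all x in B.

   Finiteness: let W be the common kernel of the g_i and g_i(a) <> 0 for all i.
   The coefficient of t^k at x = a + t w, w in W, shows that a combination of
   translates of the f_j, j >= i (k = p_i), kills all products of k elements of
   W; if k > 1 this forces every x in B to satisfy a polynomial equation of
   bounded degree modulo the largest ideal in the kernel.  For v in the ideal
   obtained from the f_i with p_i > 1, the equation at x + s v is polynomial in s
   and gives g_i(v) = 0 and f_i(v) = 0 for all i.  So B modulo the largest ideal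
   J killed by all f_i and g_i is algebraic of bounded degree, hence supported at
   finitely many characters phi of B.

   Degree: let M = ker phi and localize at phi.  Comparing degrees in x + s u shows
   by descending induction on m >= 2 that M^m is killed by every g_i and by every
   f_i for which g_i is not a multiple of phi.  For the other indices, u in M^2
   (in M if all g_i are multiples of phi) gives
   sum_i g_i(1)^q_i binom(p_i, k) f_i = 0 on M^(k+1) (resp. on M^k), and a
   Vandermonde argument yields f_i = 0 on M^n.

   Finally, if h kills M^(r+1), then h is a generalized polynomial of degree at
   most r in the variable x/phi(x) = 1 + eta, through exp(log(1 + eta)). *)

Set Implicit Arguments.
Unset Strict Implicit.
Unset Printing Implicit Defensive.

Import GRing.Theory Num.Theory.
Local Open Scope ring_scope.

(** * Linear functionals on commutative algebras *)

Section Functionals.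
Variables (K : numClosedFieldType) (B : comAlgType K).
Implicit Types (h : {scalar B}) (x y z u a b : B) (P Q : {poly K}).

(** In characteristic zero the naturals are infinitely many roots; this serves identities known only
    at natural arguments. *)
Lemma poly_eq0_nat P : (forall k : nat, P.[k%:R] = 0) -> P = 0.
Proof.
move=> P0; apply/eqP/contraT => nzP.
have := @max_poly_roots K P [seq k%:R | k <- iota 0 (size P)] nzP.
rewrite size_map size_iota ltnn => -> //; last first.
  by rewrite map_inj_uniq ?iota_uniq // => i j /eqP; rewrite eqr_nat => /eqP.
by apply/allP => _ /mapP[k _ ->]; apply/rootP.
Qed.

Lemma poly_eq0_horner P : (forall t, P.[t] = 0) -> P = 0.
Proof. by move=> P0; apply: poly_eq0_nat. Qed.

Lemma horner_algP x c P Q :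
  horner_alg x (c *: P + Q) = c *: horner_alg x P + horner_alg x Q.
Proof. by rewrite linearP /= mulr_algl. Qed.

Lemma horner_algM x P Q : horner_alg x (P * Q) = horner_alg x P * horner_alg x Q.
Proof. by rewrite rmorphM. Qed.

Definition shift a h : B -> K := fun z => h (a * z).

Fact shift_linear a h : linear_for *%R (shift a h).
Proof. by move=> c u v; rewrite /shift mulrDr -scalerAr linearP. Qed.

HB.instance Definition _ a h :=
  GRing.isLinear.Build K B K *%R (shift a h) (shift_linear a h).

Lemma shiftE a h z : (shift a h : {scalar B}) z = h (a * z).
Proof. by []. Qed.

Definition power_line h p x u : {poly K} :=
  \poly_(k < p.+1) (h (x ^+ (p - k) * u ^+ k) *+ 'C(p, k)).

Lemma horner_power_line h p x u t :
  (power_line h p x u).[t] = h ((x + t *: u) ^+ p).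
Proof.
rewrite horner_poly exprDn raddf_sum; apply: eq_bigr => k _.
by rewrite raddfMn /= exprZn -scalerAr linearZ /= mulrnAl mulrC.
Qed.

Lemma coef_power_line h p x u k :
  (power_line h p x u)`_k = h (x ^+ (p - k) * u ^+ k) *+ 'C(p, k).
Proof.
by rewrite coef_poly ltnS; case: leqP => // /bin_small ->; rewrite mulr0n.
Qed.

Definition affine_line h x u : {poly K} := (h x)%:P + h u *: 'X.

Lemma horner_affine_line h x u t : (affine_line h x u).[t] = h (x + t *: u).
Proof. by rewrite !hornerE linearD linearZ /= mulrC. Qed.

Definition submodule (M : B -> Prop) :=
  M 0 /\ forall c y z, M y -> M z -> M (y + c *: z).

(** The coefficient of [t] in [h ((y + t *: z) ^+ k.+1)] is [k.+1] times [h (z * y ^+ k)], so the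
    hypothesis passes to [shift z h] with exponent [k]. *)
Lemma polarization (M : B -> Prop) h k :
  submodule M -> (forall y, M y -> h (y ^+ k) = 0) ->
  forall ys : seq B, size ys = k -> (forall y, y \in ys -> M y) ->
  h (\prod_(y <- ys) y) = 0.
Proof.
case=> M0 MD; elim: k h => [|k IHk] h hM [|z ys] //= szys Mys.
  by rewrite big_nil; move: (hM 0 M0); rewrite expr0.
rewrite big_cons; apply: (IHk (shift z h)) => //; last 2 first.
- by case: szys.
- by move=> y ys_y; apply: Mys; rewrite inE ys_y orbT.
move=> y My; have Mz : M z by apply: Mys; rewrite mem_head.
have: power_line h k.+1 y z = 0.
  by apply: poly_eq0_horner => t; rewrite horner_power_line; apply/hM/MD.
move/(congr1 (fun P : {poly K} => P`_1)).
rewrite coef_power_line coef0 bin1 subn1 expr1 /= => /eqP.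
by rewrite mulrn_eq0 /= => /eqP; rewrite /shift mulrC.
Qed.

(** If [a] serves the first [k] functionals and [b] the next one, all of them are nonzero affine
    polynomials along [a + t *: b], and so is their product nonzero. *)
Lemma common_nonzero n (g : 'I_n -> {scalar B}) :
  (forall i, exists x, g i x != 0) -> exists a, forall i, g i a != 0.
Proof.
move=> gn0; suff: forall k, exists a, forall i : 'I_n, (i < k)%N -> g i a != 0.
  by case/(_ n) => a ga; exists a => i; apply/ga/ltn_ord.
elim=> [|k [a ga]]; first by exists 0.
have [kn|nk] := ltnP k n; last first.
  by exists a => i _; apply/ga/(leq_trans (ltn_ord i)).
have [b gb] := gn0 (Ordinal kn).
pose Q := \prod_(i < n | (i < k.+1)%N) affine_line (g i) a b.
have nzQ : Q != 0.
  apply/prodf_neq0 => i ik; apply: contraTneq isT => gi0.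
  have [gia gib] : g i a = 0 /\ g i b = 0.
    move: (congr1 (fun P : {poly K} => P`_0) gi0).
    move: (congr1 (fun P : {poly K} => P`_1) gi0).
    by rewrite !coefD !coefZ !coefC !coefX /= !mulr1 mulr0 add0r addr0.
  have [/eqP ki|ki] := eqVneq (i : nat) k.
    by rewrite (_ : Ordinal kn = i) ?gib ?eqxx // in gb; apply/val_inj/esym/eqP.
  by have := ga i; rewrite gia eqxx ltn_neqAle ki -ltnS ik; apply.
have [t Qt] : exists t, Q.[t] != 0.
  apply: contrapT => nex; case/eqP: nzQ; apply: poly_eq0_horner => t.
  by apply/eqP/contraT => ?; case: nex; exists t.
exists (a + t *: b) => i ik; move: Qt.
by rewrite horner_prod => /prodf_neq0/(_ i ik); rewrite horner_affine_line.
Qed.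

Lemma poly_linear_system m (L : 'I_m -> {poly K} -> K) :
  (forall j c P Q, L j (c *: P + Q) = c * L j P + L j Q) ->
  exists P, [/\ P != 0, (size P <= m.+1)%N & forall j, L j P = 0].
Proof.
move=> linL; pose A := \matrix_(i < m.+1, j < m) L j 'X^i.
have nzker : kermx A != 0.
  by rewrite -mxrank_eq0 mxrank_ker subn_eq0 -ltnNge ltnS rank_leq_col.
set v := nz_row (kermx A); have nzv : v != 0 by rewrite nz_row_eq0.
have vA : v *m A = 0 by apply/sub_kermxP/nz_row_sub.
exists (rVpoly v); split=> [||j]; last 1 first.
- pose Lj : {linear {poly K} -> K | *%R} :=
    HB.pack (L j) (GRing.isLinear.Build K {poly K} K *%R (L j) (linL j)).
  rewrite -[L j _]/(Lj _) /rVpoly poly_def raddf_sum /=.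
  move/rowP/(_ j): vA; rewrite !mxE => vAj; rewrite -[RHS]vAj.
  apply: eq_bigr => i _; rewrite -[L j _]/(Lj _).
  by rewrite valK mxE -[RHS]/(_ * Lj _) -linearZ.
- by apply: contraNneq nzv => v0; rewrite -[v]rVpolyK v0 linear0.
- exact: size_poly.
Qed.

(** * Common kernel of finitely many functionals *)

Section Kernel.
Variables (n : nat) (g : 'I_n -> {scalar B}).

Definition common_kernel w := forall i, g i w = 0.

Lemma common_kernel_submodule : submodule common_kernel.
Proof.
split=> [i|c y z y0 z0 i]; first by rewrite linear0.
by rewrite linearD linearZ /= y0 z0 mulr0 addr0.
Qed.

(** The common kernel has codimension at most [n], and [vs] spans [B] together with it. Stating this
    through functionals avoids quotient spaces. *)
Lemma kernel_complement : exists vs : seq B, (size vs <= n)%N /\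
  forall h, (forall w, common_kernel w -> h w = 0) ->
    (forall v, v \in vs -> h v = 0) -> forall b, h b = 0.
Proof.
suff: forall k, (k <= n)%N -> exists vs : seq B, (size vs <= k)%N /\
    forall h, (forall w, (forall i : 'I_n, (i < k)%N -> g i w = 0) -> h w = 0) ->
      (forall v, v \in vs -> h v = 0) -> forall b, h b = 0.
  case/(_ n (leqnn n)) => vs [szvs Hvs]; exists vs; split=> // h hW.
  by apply: Hvs => w gw; apply: hW => i; apply/gw/ltn_ord.
elim=> [|k IHk] kn; first by exists [::]; split=> // h hW _ b; apply: hW.
have [vs [szvs Hvs]] := IHk (ltnW kn).
case: (pselect (exists w0, (forall i : 'I_n, (i < k)%N -> g i w0 = 0) /\
                  g (Ordinal kn) w0 != 0)) => [[w0 [gw0 nz]]|nex].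
  exists (w0 :: vs); split=> // h hW hvs.
  apply: Hvs => [w gw|v v_vs]; last by apply: hvs; rewrite inE v_vs orbT.
  pose c := g (Ordinal kn) w / g (Ordinal kn) w0.
  suff: h (w - c *: w0) = 0.
    by rewrite linearB linearZ /= (hvs w0) ?mem_head // mulr0 subr0.
  apply: hW => i; rewrite ltnS leq_eqVlt => /orP[/eqP ik|ik].
    have -> : i = Ordinal kn by apply: val_inj.
    by rewrite linearB linearZ /= divfK // subrr.
  by rewrite linearB linearZ /= gw // gw0 // mulr0 subr0.
exists vs; split=> [|h hW]; first exact: leqW.
apply: Hvs => w gw; apply: hW => i; rewrite ltnS leq_eqVlt => /orP[/eqP ik|/gw//].
have -> : i = Ordinal kn by apply: val_inj.
by apply/eqP/contraT => ?; case: nex; exists w.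
Qed.

Definition algebraic_mod (J : B -> Prop) (D : nat) :=
  forall x, exists P, [/\ P != 0, (size P <= D)%N & J (horner_alg x P)].

Definition annihilator h b := forall z, h (b * z) = 0.

(** Choose [P1], then [P2], with values at [x] in the common kernel and with [h] zero on
    [P1(x)^(k-2) P2(x) v] for [v] in [vs]. For [w] in the kernel, [P1(x)^(k-2) P2(x) w] is a product
    of [k] kernel elements, so [P1^(k-2) P2] works. *)
Lemma decomposable_algebraic h k : (2 <= k)%N ->
  (forall ws : seq B, size ws = k -> (forall w, w \in ws -> common_kernel w) ->
     h (\prod_(w <- ws) w) = 0) ->
  exists D, algebraic_mod (annihilator h) D.
Proof.
move=> k2 hW; have [vs [szvs Hvs]] := kernel_complement.
(* The summands bound the sizes of [P1 ^+ (k - 2)] and [P2], where [P1] solves [n] linear conditions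
   and [P2] at most [n + n]. *)
exists ((n * (k - 2)).+1 + (n + n).+1)%N => x.
have [P1 [nzP1 szP1 gP1]] := @poly_linear_system n
  (fun j P => g j (horner_alg x P))
  (fun j c P Q => etrans (congr1 (g j) (horner_algP x c P Q)) (linearP (g j) _ _ _)).
pose L j P := match split j : 'I_n + 'I_(size vs) with
  | inl i => g i (horner_alg x P)
  | inr i => h (horner_alg x (P1 ^+ (k - 2) * P) * vs`_i) end.
have [|P2 [nzP2 szP2 LP2]] := @poly_linear_system (n + size vs) L.
  move=> j c P Q; rewrite /L; case: split => i.
    by rewrite horner_algP linearP.
  by rewrite mulrDr -scalerAr horner_algP mulrDl -scalerAl linearP.
exists (P1 ^+ (k - 2) * P2); split; first by rewrite mulf_neq0 ?expf_neq0.
  apply: (leq_trans (size_polyMleq _ _)); apply: (leq_trans (leq_pred _)).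
  apply: leq_add; last by apply: (leq_trans szP2); rewrite ltnS leq_add2l.
  apply: (leq_trans (size_poly_exp_leq _ _)); rewrite ltnS leq_mul //.
  by case: (size P1) szP1.
have gP2 : common_kernel (horner_alg x P2).
  by move=> i; have := LP2 (lshift _ i); rewrite /L (unsplitK (inl i)).
apply: (Hvs (shift (horner_alg x (P1 ^+ (k - 2) * P2)) h)) => [w gw|v v_vs].
  rewrite -[LHS]/(h (_ * w)) rmorphM rmorphXn /= -mulrA.
  have -> : horner_alg x P1 ^+ (k - 2) * (horner_alg x P2 * w) =
            \prod_(w <- nseq (k - 2) (horner_alg x P1) ++
                        [:: horner_alg x P2; w]) w.
    by rewrite big_cat big_nseq !big_cons big_nil /= iter_mulr !mulr1.
  apply: hW => [|y]; first by rewrite size_cat size_nseq /= subnK.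
  rewrite mem_cat mem_nseq !inE => /orP[/andP[_ /eqP ->]|] //.
  by case/orP=> /eqP ->.
have iv : (index v vs < size vs)%N by rewrite index_mem.
have := LP2 (rshift _ (Ordinal iv)).
by rewrite /L (unsplitK (inr _)) /= nth_index.
Qed.

End Kernel.
End Functionals.

(** * Points of an algebra of bounded degree *)

Section Spectrum.
Variables (K : numClosedFieldType) (B : comAlgType K).
Implicit Types (J : B -> Prop) (x y z a b c e : B) (P : {poly K}).

Definition ideal J := J 0 /\ forall c a b, J a -> J b -> J (a + c * b).

Lemma ideal_mull J c a : ideal J -> J a -> J (c * a).
Proof. by case=> J0 JD Ja; rewrite -[_ * _]add0r; apply: JD. Qed.

Lemma ideal_mulr J c a : ideal J -> J a -> J (a * c).
Proof. by rewrite mulrC; apply: ideal_mull. Qed.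

Lemma ideal_add J a b : ideal J -> J a -> J b -> J (a + b).
Proof. by case=> J0 JD Ja Jb; rewrite -[b]mul1r; apply: JD. Qed.

Lemma ideal_sub J a b : ideal J -> J a -> J b -> J (a - b).
Proof. by case=> J0 JD Ja Jb; rewrite -mulN1r; apply: JD. Qed.

Lemma ideal_sum J (I : Type) (r : seq I) (Q : pred I) (F : I -> B) :
  ideal J -> (forall i, Q i -> J (F i)) -> J (\sum_(i <- r | Q i) F i).
Proof.
by move=> idJ JF; elim/big_ind: _ => //; [case: idJ | move=> *; apply: ideal_add].
Qed.

Lemma annihilator_ideal (h : {scalar B}) : ideal (annihilator h).
Proof.
split=> [z|c a b ha hb z]; first by rewrite mul0r linear0.
by rewrite mulrDl linearD /= ha mulrAC mulrC hb addr0.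
Qed.

Definition colon J e := fun z => J (e * z).

Lemma colon_ideal J e : ideal J -> ideal (colon J e).
Proof.
move=> idJ; split=> [|c a b]; first by rewrite /colon mulr0; case: idJ.
by rewrite /colon mulrDr mulrCA; case: idJ => _; apply.
Qed.

Lemma colon_algebraic J e D :
  ideal J -> algebraic_mod J D -> algebraic_mod (colon J e) D.
Proof.
by move=> idJ algJ x; have [P [? ? JP]] := algJ x; exists P; split=> //; apply: ideal_mull.
Qed.

Definition invertible_mod J x := exists y, J (x * y - 1).

(** The spectrum of [x] in the quotient of [B] by [J]; the quotient itself is never formed. *)
Definition eigen J x l := ~ invertible_mod J (x - l%:A).

Definition nilpotent_mod J a := exists k, J (a ^+ k).

Lemma nilpotent_modD J a b : ideal J ->
  nilpotent_mod J a -> nilpotent_mod J b -> nilpotent_mod J (a + b).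
Proof.
move=> idJ [k Ja] [l Jb]; exists (k + l)%N; rewrite exprDn.
apply: ideal_sum => // i _; rewrite -mulr_natl; apply: ideal_mull => //.
have [ik|ki] := leqP i l.
  by apply: ideal_mulr => //; rewrite -addnBA // exprD; apply: ideal_mulr.
by apply: ideal_mull => //; rewrite -(subnK (ltnW ki)) exprD; apply: ideal_mull.
Qed.

Lemma nilpotent_modM J c a : ideal J -> nilpotent_mod J a -> nilpotent_mod J (c * a).
Proof. by move=> idJ [k Ja]; exists k; rewrite exprMn; apply: ideal_mull. Qed.

Lemma invertible_modMr J c a : ideal J -> invertible_mod J (c * a) -> invertible_mod J a.
Proof. by move=> idJ [y Jy]; exists (c * y); rewrite mulrCA mulrA. Qed.

(** If [c] inverts [a + b], then [b * c] is [1 - a * c] modulo [J], and the finite geometric series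
    [T] inverts it. *)
Lemma invertible_mod_nilpotent J a b : ideal J ->
  nilpotent_mod J a -> invertible_mod J (a + b) -> invertible_mod J b.
Proof.
move=> idJ [k Ja] [c Jc]; pose T := \sum_(i < k) (a * c) ^+ i.
exists (c * T).
have -> : b * (c * T) - 1 = ((a + b) * c - 1) * T - (a ^+ k * c ^+ k).
  have := subrX1 (a * c) k; rewrite -/T exprMn => E.
  have -> : a ^+ k * c ^+ k = 1 + (a * c - 1) * T by rewrite -E; ring.
  by ring.
by apply: ideal_sub => //; apply: ideal_mulr.
Qed.

Lemma invertible_mod_sub J J' a : (forall z, J z -> J' z) ->
  invertible_mod J a -> invertible_mod J' a.
Proof. by move=> JJ' [y Jy]; exists y; apply: JJ'. Qed.

Lemma proper_not_invertible J a : ideal J -> ~ J 1 -> J a -> ~ invertible_mod J a.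
Proof.
move=> idJ J1 Ja [y Jy]; apply: J1.
have -> : 1 = a * y - (a * y - 1) by ring.
by apply: ideal_sub => //; apply: ideal_mulr.
Qed.

Lemma horner_alg_factor x P l :
  exists b, horner_alg x P = P.[l]%:A + (x - l%:A) * b.
Proof.
have /factor_theorem[Q EQ] : root (P - P.[l]%:P) l by rewrite /root !hornerE subrr.
exists (horner_alg x Q); rewrite -[P in LHS](subrK P.[l]%:P) EQ.
by rewrite rmorphD rmorphM rmorphB /= !horner_algC horner_algX addrC mulrC.
Qed.

(** Writing [P(x) = P(l) + (x - l) b], a nonzero [P(l)] would make [- b / P(l)] an inverse of
    [x - l]. *)
Lemma eigen_root J x P l :
  ideal J -> J (horner_alg x P) -> eigen J x l -> root P l.
Proof.
move=> idJ; have [b ->] := horner_alg_factor x P l => JP ev.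
apply/rootP/eqP/contraT => nz; case: ev; exists (- (P.[l]^-1 *: b)).
set d := x - l%:A in JP *.
have -> : d * - (P.[l]^-1 *: b) - 1 = (- P.[l]^-1)%:A * (P.[l]%:A + d * b).
  rewrite mulr_algl scalerDr scalerA mulNr mulVf // scaleN1r scaleNr addrC.
  by rewrite mulrN -scalerAr.
exact: ideal_mull.
Qed.

(** A factor with [l] outside [s] is invertible and cancels; one with [l] in [s] divides the product
    over [s]. One copy of that product per entry of [rs] is thus enough. *)
Lemma eigen_prod J x z (s rs : seq K) : ideal J ->
  (forall l, eigen J x l -> l \in s) ->
  J (z * \prod_(l <- rs) (x - l%:A)) ->
  J (z * (\prod_(l <- s) (x - l%:A)) ^+ size rs).
Proof.
move=> idJ sP; elim: rs z => [|l rs IH] z /=.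
  by rewrite big_nil expr0.
rewrite big_cons mulrA => /IH; set Q := \prod_(l <- s) _ => JQ.
have [ls|ls] := boolP (l \in s).
  rewrite exprS mulrA {1}/Q (perm_big _ (perm_to_rem ls)) big_cons /=.
  rewrite [_ * \prod_(_ <- _) _]mulrC mulrCA -mulrA.
  exact: ideal_mull.
have [y Jy] : invertible_mod J (x - l%:A).
  by apply: contrapT => /sP; rewrite (negPf ls).
rewrite exprS mulrCA; apply: ideal_mull => //.
have -> : z * Q ^+ size rs =
  z * (x - l%:A) * Q ^+ size rs * y - ((x - l%:A) * y - 1) * (z * Q ^+ size rs).
  by set d := x - l%:A; ring.
by apply: ideal_sub => //; apply: ideal_mulr.
Qed.

Section Ideal.
Variables (J : B -> Prop) (D : nat).
Hypotheses (idJ : ideal J) (algJ : algebraic_mod J D).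

Lemma eigen_nilpotent x s : (forall l, eigen J x l -> l \in s) ->
  J ((\prod_(l <- s) (x - l%:A)) ^+ D).
Proof.
move=> sP; have [P [nzP szP JP]] := algJ x.
have [rs EP] := closed_field_poly_normal P.
have nzl : lead_coef P != 0 by rewrite lead_coef_eq0.
have rsD : (size rs <= D)%N.
  by move: szP; rewrite EP size_scale // size_prod_XsubC => /ltnW.
rewrite -(subnK rsD) exprD -[X in _ * X]mul1r; apply: ideal_mull => //.
apply: eigen_prod => //.
have -> : 1 * \prod_(l <- rs) (x - l%:A) = (lead_coef P)^-1%:A * horner_alg x P.
  rewrite [P in horner_alg x P]EP -mul_polyC rmorphM /= horner_algC mulrA.
  rewrite -!in_algE -rmorphM mulVf // rmorph1 rmorph_prod; congr (_ * _).
  by apply: eq_bigr => l _; rewrite rmorphB /= horner_algX horner_algC.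
exact: ideal_mull.
Qed.

Lemma eigen_exists x : ~ J 1 -> exists l, eigen J x l.
Proof.
move=> J1; apply: contrapT => noeig; apply: J1.
have := @eigen_nilpotent x [::]; rewrite big_nil expr1n; apply.
by move=> l ev; case: noeig; exists l.
Qed.

Lemma eigen_bound x s : uniq s -> (forall l, l \in s -> eigen J x l) -> (size s < D)%N.
Proof.
move=> us sP; have [P [nzP szP JP]] := algJ x.
apply: leq_trans szP; apply: max_poly_roots => //.
by apply/allP => l /sP; apply: eigen_root.
Qed.

End Ideal.

(** * Points of the quotient and a partition of unity *)

Definition character (phi : B -> K) :=
  [/\ phi 1 = 1, forall a b, phi (a + b) = phi a + phi b,
      forall a b, phi (a * b) = phi a * phi b
    & forall k a, phi (k *: a) = k * phi a].

Section Decomposition.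
Variables (J : B -> Prop) (D : nat).
Hypotheses (idJ : ideal J) (algJ : algebraic_mod J D).

(** An [x] with the most eigenvalues separates the points of the quotient; [eigen_bound] guarantees
    that a maximum exists. *)
Lemma maximal_spectrum : exists x s, [/\ uniq s, forall l, l \in s <-> eigen J x l
  & forall x' s', uniq s' -> (forall l, l \in s' -> eigen J x' l) ->
      (size s' <= size s)%N].
Proof.
pose Q k := `[< exists x s, [/\ uniq s, forall l, l \in s -> eigen J x l & size s = k] >].
have exQ : exists k, Q k by exists 0%N; apply/asboolP; exists 0, [::].
have bQ k : Q k -> (k <= D)%N.
  by case/asboolP=> x [s [us sP <-]]; apply/ltnW/(eigen_bound idJ algJ us sP).
case: (ex_maxnP exQ bQ) => k /asboolP[x [s [us sP szs]]] kmax.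
exists x, s; split=> // [l|x' s' us' sP'].
  split=> [|ev]; first exact: sP.
  apply/contraT => ls; suff: (k.+1 <= k)%N by rewrite ltnn.
  apply/kmax/asboolP; exists x, (l :: s); split=> /=; rewrite ?ls ?szs //.
  by move=> m; rewrite inE => /orP[/eqP ->|/sP].
by rewrite szs; apply/kmax/asboolP; exists x', s'.
Qed.

Section Points.
Variables (x : B) (s : seq K).
Hypotheses (us : uniq s) (sP : forall l, l \in s <-> eigen J x l)
  (smax : forall x' s', uniq s' -> (forall l, l \in s' -> eigen J x' l) ->
      (size s' <= size s)%N).

(** Vanishing to order [D] at the other eigenvalues makes [block l] supported at the point where [x]
    takes the value [l]; [loc l] is the kernel of localization there. *)
Definition cofactor l : {poly K} := (\prod_(m <- rem l s) ('X - m%:P)) ^+ D.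
Definition block l := horner_alg x (cofactor l).
Notation loc l := (colon J (block l)).

Lemma blockE l : block l = (\prod_(m <- rem l s) (x - m%:A)) ^+ D.
Proof.
rewrite /block rmorphXn rmorph_prod; congr (_ ^+ _); apply: eq_bigr => m _.
by rewrite rmorphB /= horner_algX horner_algC.
Qed.

Lemma cofactor_neq0 l : (cofactor l).[l] != 0.
Proof.
rewrite horner_exp expf_neq0 // horner_prod prodf_seq_neq0.
apply/allP => m; rewrite mem_rem_uniq // !inE => /andP[ml _].
by rewrite !hornerE subr_eq0 eq_sym.
Qed.

Lemma loc_ideal l : ideal (loc l).
Proof. exact: colon_ideal. Qed.

Lemma sub_loc l z : J z -> loc l z.
Proof. exact: ideal_mull. Qed.

Lemma loc_nilpotent l : l \in s -> nilpotent_mod (loc l) (x - l%:A).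
Proof.
move=> ls; exists D; rewrite /colon blockE -exprMn mulrC.
have := @eigen_nilpotent J D idJ algJ x s.
rewrite (perm_big _ (perm_to_rem ls)) big_cons; apply=> m; exact: (sP m).2.
Qed.

Lemma loc_proper l : l \in s -> ~ loc l 1.
Proof.
rewrite /colon mulr1 => ls /eigen_root => /(_ l idJ ((sP l).1 ls)).
by rewrite /root (negPf (cofactor_neq0 l)).
Qed.

Lemma loc_block l k : k \in s -> k != l -> loc k (block l).
Proof.
move=> ks kl; have kl' : k \in rem l s by rewrite mem_rem_uniq // !inE kl.
rewrite /colon [block l]blockE (perm_big _ (perm_to_rem kl')) big_cons exprMn mulrA.
apply: ideal_mulr => //; rewrite blockE -exprMn mulrC.
have := @eigen_nilpotent J D idJ algJ x s.
rewrite (perm_big _ (perm_to_rem ks)) big_cons; apply=> m; exact: (sP m).2.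
Qed.

(* A second local eigenvalue would split off an extra eigenvalue of a
   perturbation of x supported at the point l. *)
Lemma loc_eigen_unique l y m m' : l \in s ->
  eigen (loc l) y m -> eigen (loc l) y m' -> m = m'.
Proof.
move=> ls evm evm'; apply/eqP/contraT => mm'.
have [r rs] : exists r, r \notin s.
  apply: contrapT => nex; have: \prod_(l <- s) ('X - l%:P) != 0 :> {poly K}.
    by rewrite monic_neq0 ?monic_prod_XsubC.
  case/eqP; apply: poly_eq0_horner => t; apply/rootP; rewrite root_prod_XsubC.
  by apply/contraT => ts; case: nex; exists t.
have [b Eb] := horner_alg_factor x (cofactor l) l; rewrite -/(block l) in Eb.
(* [rho] is the value of [block l] at the point, and [t] is chosen so that [z] has there the
   eigenvalue [l] from [m] and the new one [r] from [m'], keeping those at the other points. *)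
pose rho := (cofactor l).[l]; pose t := (r - l) / (rho * (m' - m)).
have nzd : rho * (m' - m) != 0.
  by rewrite mulf_neq0 ?cofactor_neq0 // subr_eq0 eq_sym.
have Er : r = l + t * rho * (m' - m) by rewrite -mulrA divfK // addrC subrK.
rewrite -/rho in Eb; clearbody t; clearbody rho.
pose z := x + t%:A * (block l * (y - m%:A)).
suff: (size (r :: s) <= size s)%N by rewrite ltnn.
apply: (@smax z) => /=; first by rewrite rs.
move=> k; rewrite inE => /orP[/eqP ->|ks] inv.
  have {}inv := invertible_mod_sub (@sub_loc l) inv; apply: evm'.
  apply: (@invertible_modMr _ (t * rho)%:A); first exact: loc_ideal.
  have nil := @nilpotent_modM _ (1 + t%:A * b * (y - m%:A)) _ (loc_ideal l)
    (loc_nilpotent ls).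
  apply: (invertible_mod_nilpotent (loc_ideal l) nil).
  suff -> : (1 + t%:A * b * (y - m%:A)) * (x - l%:A) + (t * rho)%:A * (y - m'%:A) =
     z - r%:A by [].
  rewrite /z Eb Er -!in_algE !(rmorphD, rmorphM, rmorphN) /=; ring.
have [kl|kl] := eqVneq k l.
  have {}inv := invertible_mod_sub (@sub_loc l) inv; apply: evm.
  apply: (@invertible_modMr _ (t%:A * block l)); first exact: loc_ideal.
  apply: (invertible_mod_nilpotent (loc_ideal l) (loc_nilpotent ls)).
  suff -> : x - l%:A + t%:A * block l * (y - m%:A) = z - k%:A by [].
  by rewrite kl /z mulrA addrAC.
have {}inv := invertible_mod_sub (@sub_loc k) inv.
apply: (@proper_not_invertible (loc k) (t%:A * (block l * (y - m%:A)))).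
- exact: loc_ideal.
- exact: loc_proper.
- by apply: (ideal_mull _ (loc_ideal k)); apply: (ideal_mulr _ (loc_ideal k)); apply: loc_block.
apply: (invertible_mod_nilpotent (loc_ideal k) (loc_nilpotent ks)).
suff -> : x - k%:A + t%:A * (block l * (y - m%:A)) = z - k%:A by [].
by rewrite /z addrAC.
Qed.

(** Modulo [loc l] each [y] has exactly one eigenvalue [phi y], and [y - phi y] is nilpotent.
    Nilpotents form an ideal, so uniqueness of the eigenvalue makes [phi] additive and
    multiplicative. *)
Lemma point_exists l : l \in s -> exists phi, [/\ character phi,
  forall z, J z -> phi z = 0 & forall y, phi y = 0 -> loc l (y ^+ D)].
Proof.
move=> ls; have idl := loc_ideal l.
have [phi phiP] := choice (fun y => eigen_exists idl
  (colon_algebraic (block l) idJ algJ) y (loc_proper ls)).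
have phi_nil y : loc l ((y - (phi y)%:A) ^+ D).
  have := @eigen_nilpotent _ D idl (colon_algebraic (block l) idJ algJ) y [:: phi y].
  rewrite big_seq1; apply=> m evm; rewrite inE; apply/eqP.
  exact: loc_eigen_unique evm (phiP y).
have phiE y m : nilpotent_mod (loc l) (y - m%:A) -> phi y = m.
  move=> nil; apply: (loc_eigen_unique ls (phiP y)) => inv.
  apply: (proper_not_invertible idl (loc_proper ls) idl.1).
  by apply: (invertible_mod_nilpotent idl nil); rewrite addr0.
have nilD y : nilpotent_mod (loc l) (y - (phi y)%:A) by exists D.
have nilJ z : loc l z -> nilpotent_mod (loc l) z by exists 1%N; rewrite expr1.
have phi_alg k : phi k%:A = k by apply: phiE; rewrite subrr; apply/nilJ/idl.1.
have phiM a b : phi (a * b) = phi a * phi b.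
  apply: phiE; rewrite -in_algE rmorphM /=.
  have -> : a * b - (phi a)%:A * (phi b)%:A =
    b * (a - (phi a)%:A) + (phi a)%:A * (b - (phi b)%:A) by ring.
  by apply: nilpotent_modD => //; apply: nilpotent_modM.
exists phi; split=> [|z Jz|y phiy].
- split=> [|a b|//|k a]; last by rewrite -mulr_algl phiM phi_alg.
    by have := phi_alg 1; rewrite scale1r.
  apply: phiE; rewrite scalerDl.
  have -> : a + b - ((phi a)%:A + (phi b)%:A) =
    (a - (phi a)%:A) + (b - (phi b)%:A) by ring.
  exact: nilpotent_modD.
- by apply: phiE; rewrite scale0r subr0; apply/nilJ/sub_loc.
- by have := phi_nil y; rewrite phiy scale0r subr0.
Qed.

(** If [J] and the blocks generated a proper ideal [I], [x] would have an eigenvalue [k] modulo [I].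
    It lies in [s] since [I] contains [J], but [block k] in [I] forces [cofactor k] to vanish at
    [k]. *)
Lemma block_partition : exists b : K -> B, J (1 - \sum_(l <- s) b l * block l).
Proof.
pose I z := exists b : K -> B, J (z - \sum_(l <- s) b l * block l).
have idI : ideal I.
  split=> [|c a1 a2 [b1 Jb1] [b2 Jb2]].
    exists (fun=> 0); rewrite big1 ?subr0; first by case: idJ.
    by move=> l _; rewrite mul0r.
  exists (fun l => b1 l + c * b2 l).
  have -> : a1 + c * a2 - \sum_(l <- s) (b1 l + c * b2 l) * block l =
    (a1 - \sum_(l <- s) b1 l * block l) + c * (a2 - \sum_(l <- s) b2 l * block l).
    rewrite mulrBr mulr_sumr addrACA -opprD -big_split; congr (_ - _).
    by apply: eq_bigr => l _; rewrite mulrDl mulrA.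
  by case: idJ => _; apply.
have JI z : J z -> I z.
  move=> Jz; exists (fun=> 0); rewrite big1 ?subr0 // => l _; exact: mul0r.
apply: contrapT => I1.
have algI : algebraic_mod I D.
  by move=> y; have [P [? ? ?]] := algJ y; exists P; split=> //; apply: JI.
have [k evk] := eigen_exists idI algI x I1.
have ks : k \in s.
  by apply/(sP k).2 => inv; apply: evk; apply: invertible_mod_sub inv.
have: I (block k).
  exists (fun l => (l == k)%:R); rewrite (bigD1_seq k) //= eqxx mul1r big1 ?addr0 ?subrr.
    by case: idJ.
  by move=> l /negPf ->; rewrite mul0r.
move/eigen_root => /(_ k idI evk).
by rewrite /root (negPf (cofactor_neq0 k)).
Qed.

End Points.

Lemma local_decomposition : exists (m : nat) (c : 'I_m -> B) (phi : 'I_m -> B -> K),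
  J (1 - \sum_(j < m) c j) /\
  forall j, [/\ character (phi j), forall z, J z -> phi j z = 0
              & forall y, phi j y = 0 -> J (c j * y ^+ D)].
Proof.
have [x [s [us sP smax]]] := maximal_spectrum.
have [b Jb] := block_partition us sP.
have sn (j : 'I_(size s)) : s`_j \in s by rewrite mem_nth.
have [phi phiP] := choice (fun j => point_exists us sP smax (sn j)).
exists (size s), (fun j => b s`_j * block x s s`_j), phi; split.
  by rewrite (big_nth 0) big_mkord in Jb.
move=> j; have [? ? nil] := phiP j; split=> // y /nil Jy; rewrite -mulrA.
exact: ideal_mull idJ Jy.
Qed.

End Decomposition.
End Spectrum.

(** * Finiteness *)

Section Equation.
Variables (K : numClosedFieldType) (B : comAlgType K) (n N : nat).
Variables (p q : 'I_n -> nat) (f g : 'I_n -> {scalar B}).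
Implicit Types (x y z u v a b : B) (i j : 'I_n) (P F : {poly K}).

Lemma coef_affine_lineX (h : {scalar B}) x u m k :
  (affine_line h x u ^+ m)`_k = (h x ^+ (m - k) * h u ^+ k) *+ 'C(m, k).
Proof.
rewrite /affine_line -mul_polyC exprDn coef_sum.
under eq_bigr => i _ do rewrite coefMn exprMn -!rmorphXn /= mulrA -polyCM coefCM coefXn.
have [km|mk] := leqP k m.
  rewrite (bigD1 (inord k)) //= inordK ?ltnS // eqxx mulr1 big1 ?addr0 // => i ik.
  rewrite (_ : (k == i) = false) ?mulr0 ?mul0rn //; apply: contraNF ik => /eqP ->.
  by rewrite inord_val.
rewrite bin_small // mulr0n big1 // => i _.
by rewrite (_ : (k == i) = false) ?mulr0 ?mul0rn //; apply/eqP; move: (ltn_ord i); lia.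
Qed.

Lemma coef_mul_size2 F P k : (size F <= 2)%N ->
  (F * P)`_k.+1 = F`_0 * P`_k.+1 + F`_1 * P`_k.
Proof.
move=> szF; rewrite coefM big_ord_recl big_ord_recl /= subn0 subSS subn0.
by rewrite big1 ?addr0 // => i _; rewrite nth_default ?mul0r // (leq_trans szF).
Qed.

Lemma algebraic_mod_family (Q : 'I_n -> Prop) (J : 'I_n -> B -> Prop) :
  (forall i, ideal (J i)) ->
  (forall i, Q i -> exists D, algebraic_mod (J i) D) ->
  exists D, algebraic_mod (fun z => forall i, Q i -> J i z) D.
Proof.
move=> idJ algJ.
suff: forall k, exists D,
    algebraic_mod (fun z => forall i, (i < k)%N -> Q i -> J i z) D.
  case/(_ n) => D algD; exists D => x; have [P [? ? JP]] := algD x.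
  by exists P; split=> // i; apply: JP.
elim=> [|k [D algD]].
  by exists 1%N => x; exists 1; rewrite oner_neq0 size_poly1; split.
have [kn|nk] := ltnP k n; last first.
  exists D => x; have [P [? ? JP]] := algD x; exists P; split=> // i _.
  by apply: JP; apply: leq_trans nk.
case: (pselect (Q (Ordinal kn))) => [Qk|Qk]; last first.
  exists D => x; have [P [? ? JP]] := algD x; exists P; split=> // i.
  rewrite ltnS leq_eqVlt => /orP[/eqP ik|]; last exact: JP.
  by have -> : i = Ordinal kn by apply: val_inj.
have [D' algD'] := algJ _ Qk; exists (D + D')%N => x.
have [[P [nzP szP JP]] [P' [nzP' szP' JP']]] := (algD x, algD' x).
exists (P * P'); split; first by rewrite mulf_neq0.
  apply: (leq_trans (size_polyMleq _ _)); apply: (leq_trans (leq_pred _)).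
  exact: leq_add.
move=> i; rewrite ltnS leq_eqVlt horner_algM => /orP[/eqP ik|ik] Qi.
  have -> : i = Ordinal kn by apply: val_inj.
  by apply: ideal_mull => //.
exact: ideal_mulr (idJ i) (JP i ik Qi).
Qed.

Hypotheses (p_gt0 : forall i, (0 < p i)%N) (q_gt0 : forall i, (0 < q i)%N)
  (p_incr : forall i j, (i < j)%N -> (p i < p j)%N)
  (pqN : forall i, (p i + q i)%N = N) (p_lt_q : forall i j, i != j -> (p i < q j)%N)
  (p_le_q : forall i, (p i <= q i)%N).
Hypotheses (f_neq0 : forall i, exists x, f i x != 0)
  (g_neq0 : forall i, exists x, g i x != 0)
  (fgE : forall x, \sum_(i < n) f i (x ^+ p i) * g i x ^+ q i = 0).

Lemma q_neq i j : i != j -> q i != q j.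
Proof.
move=> ij; have : (i < j)%N || (j < i)%N by rewrite -neq_ltn.
by case/orP=> /p_incr; move: (pqN i) (pqN j); lia.
Qed.

(** For the last index, [p] is at least 2, and [q] is at least [p] and the smallest of all [q j]. *)
Lemma q_gt1 j : (1 < n)%N -> (1 < q j)%N.
Proof.
move=> n_gt1.
have n2 : (n.-1 < n)%N by move: n_gt1; lia.
have := p_le_q (Ordinal n2); have := pqN (Ordinal n2); have := pqN j.
have p2 : (1 < p (Ordinal n2))%N.
  apply: leq_ltn_trans (p_gt0 (Ordinal (ltnW n_gt1))) (p_incr _) => /=.
  by move: n_gt1; lia.
have : (p j <= p (Ordinal n2))%N.
  have [->//|jn] := eqVneq j (Ordinal n2); apply/ltnW/p_incr => /=.
  by move: (ltn_ord j) jn; rewrite -val_eqE /=; lia.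
by move: p2; lia.
Qed.

(** Otherwise polarization at [x, 1, ..., 1] would give [f i x = 0] for all [x]. *)
Lemma f_power_neq0 i : exists x, f i (x ^+ p i) != 0.
Proof.
apply: contrapT => nex; have [x] := f_neq0 i; case/eqP.
have fp0 y : True -> f i (y ^+ p i) = 0.
  by move=> _; apply/eqP/contraT => ?; case: nex; exists y.
have subT : submodule (fun _ : B => True) by [].
have := polarization subT fp0 (ys := x :: nseq (p i).-1 1).
rewrite big_cons big_nseq /= size_nseq prednK // iter_mulr expr1n !mulr1.
exact.
Qed.

Lemma line_identity x u :
  \sum_(i < n) power_line (f i) (p i) x u * affine_line (g i) x u ^+ q i = 0.
Proof.
apply: poly_eq0_horner => t; rewrite -[RHS](fgE (x + t *: u)) horner_sum.
apply: eq_bigr => i _.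
by rewrite hornerM horner_exp horner_power_line horner_affine_line.
Qed.

(** With a single index the line identity is a zero product of two polynomials, and [x] and [u] can
    be chosen to make both factors nonzero. *)
Lemma index_gt1 : (0 < n)%N -> (1 < n)%N.
Proof.
move=> n0; rewrite ltnNge; apply/negP => n1; pose i := Ordinal n0.
have [x fx] := f_power_neq0 i; have [u gu] := g_neq0 i.
have := line_identity x u; rewrite (bigD1 i) //= big1 ?addr0; last first.
  by move=> j /eqP[]; apply: val_inj => /=; move: (ltn_ord j); lia.
move/eqP; rewrite mulf_eq0 expf_eq0 q_gt0 /= => /orP[] /eqP F0.
  have := congr1 (fun P => P`_0) F0; rewrite coef_power_line coef0 subn0 expr0 mulr1.
  by rewrite bin0 => /eqP; rewrite mulr1n (negPf fx).
have := congr1 (fun P => P`_1) F0; rewrite coef0 -[affine_line _ _ _]expr1 coef_affine_lineX.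
by rewrite subnn binn mulr1n mul1r => /eqP; rewrite (negPf gu).
Qed.

Definition shifted_sum (c : 'I_n -> K) (a : 'I_n -> B) : B -> K :=
  fun z => \sum_i c i * f i (a i * z).

Fact shifted_sum_linear c (a : 'I_n -> B) : linear_for *%R (shifted_sum c a).
Proof.
move=> k u v; rewrite /shifted_sum mulr_sumr -big_split; apply: eq_bigr => i _.
by rewrite /= mulrDr -scalerAr linearP /= mulrDr mulrCA.
Qed.

HB.instance Definition _ c (a : 'I_n -> B) :=
  GRing.isLinear.Build K B K *%R (shifted_sum c a) (shifted_sum_linear c a).

(** Descending induction on [i]: [decomposable_algebraic] handles a combination [h] of translates of
    the [f j] with [j >= i], and multiplying by a polynomial for the later [f j] isolates [f i]. *)
Lemma f_algebraic i : (1 < p i)%N -> exists D, algebraic_mod (annihilator (f i)) D.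
Proof.
have [a ga] := common_nonzero g_neq0.
have [m mi] := ubnP (n - i); elim: m => // m IHm in i mi * => p1.
(* With [k = p i] the binomial coefficient removes the indices below [i], and index [i] itself
   contributes a nonzero multiple of [f i]. *)
pose k := p i; pose c j := g j a ^+ q j *+ 'C(p j, k).
pose h : {scalar B} := shifted_sum c (fun j => a ^+ (p j - k)).
have hw w : common_kernel g w -> h (w ^+ k) = 0.
  move=> gw; have := congr1 (fun P => P`_k) (line_identity a w).
  rewrite coef0 coef_sum => <-; apply: eq_bigr => j _.
  rewrite /affine_line gw scale0r addr0 -rmorphXn coefMC coef_power_line.
  by rewrite /c mulrnAl -mulrnAr mulrC.
have [Dh algh] := decomposable_algebraic p1 (polarization (common_kernel_submodule g) hw).
have [|D algD] := @algebraic_mod_family (fun j => (i < j)%N)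
  (fun j => annihilator (f j)) (fun j => annihilator_ideal (f j)).
  move=> j ij; apply: IHm; last by apply: leq_trans p1 _; apply/ltnW/p_incr.
  by move: mi ij (ltn_ord j); lia.
exists (Dh + D)%N => x.
have [[P [nzP szP hP]] [P' [nzP' szP' fP']]] := (algh x, algD x).
exists (P * P'); split; first by rewrite mulf_neq0.
  apply: (leq_trans (size_polyMleq _ _)); apply: (leq_trans (leq_pred _)).
  exact: leq_add.
move=> z; rewrite horner_algM; set y := _ * z.
have: h y = 0 by rewrite /y -mulrA; apply: hP.
rewrite -[h y]/(\sum_j c j * f j (a ^+ (p j - k) * y)) (bigD1 i) //= big1 => [|j ji].
  rewrite addr0 /c /k binn subnn mul1r mulr1n => /eqP.
  by rewrite mulf_eq0 expf_eq0 (negPf (ga i)) andbF => /eqP.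
have : (i < j)%N || (j < i)%N by rewrite -neq_ltn eq_sym.
case/orP=> ij; last by rewrite /c bin_small ?p_incr // mulr0n mul0r.
have -> : a ^+ (p j - k) * y = horner_alg x P' * (a ^+ (p j - k) * horner_alg x P * z).
  by rewrite /y /=; ring.
by rewrite fP' // mulr0.
Qed.

Definition annihilator_all z := forall i b, f i (z * b) = 0 /\ g i (z * b) = 0.

Lemma annihilator_all_ideal : ideal annihilator_all.
Proof.
split=> [i b|c a b Ja Jb i z]; first by rewrite mul0r !linear0.
have [[fa ga] [fb gb]] := (Ja i z, Jb i (c * z)).
by rewrite mulrDl !linearD /= fa ga [c * b]mulrC -mulrA fb gb addr0.
Qed.

(** Take [i] with [g i v != 0] and [q i] maximal. Along [x + t *: v] the [f] factor has degree at
    most 1, and degree 0 if [p j > 1], as for every other [j] with [g j v != 0]. Degrees [q i + 1]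
    and [q i] then give [f i (x ^+ p i) = 0] for all [x]. *)
Lemma g_vanish v : (1 < n)%N ->
  (forall i, (1 < p i)%N -> annihilator (f i) v) -> forall i, g i v = 0.
Proof.
move=> n1 fv i1; apply/eqP/contraT => gv1.
case: (@arg_maxnP _ i1 (fun i => g i v != 0) q gv1) => i gv imax_.
have imax j : g j v != 0 -> (q j <= q i)%N := imax_ j.
have q2 j : (1 < q j)%N by apply: q_gt1.
have F0 x j k : (1 < p j)%N -> (0 < k)%N -> (power_line (f j) (p j) x v)`_k = 0.
  move=> pj k0; rewrite coef_power_line -(prednK k0) exprS mulrCA fv //.
  by rewrite mul0rn.
have F2 x j k : (1 < k)%N -> (power_line (f j) (p j) x v)`_k = 0.
  move=> k1; have [pj|pj] := ltnP 1 (p j); first by rewrite F0 // ltnW.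
  by rewrite coef_power_line bin_small ?mulr0n //; apply: leq_ltn_trans k1.
have szF x j : (size (power_line (f j) (p j) x v) <= 2)%N by apply/leq_sizeP => k /F2.
have p1 j : j != i -> g j v != 0 -> (1 < p j)%N.
  move=> ji /imax qj; have := q_neq ji; move: (pqN i) (pqN j) (p_gt0 i).
  by move: qj; rewrite /=; lia.
have G0 x j k : g j v = 0 -> (0 < k)%N -> (affine_line (g j) x v ^+ q j)`_k = 0.
  by move=> gj k0; rewrite coef_affine_lineX gj expr0n (gtn_eqF k0) mulr0 mul0rn.
have term0 x j k : j != i -> (q i <= k.+1)%N ->
    (power_line (f j) (p j) x v * affine_line (g j) x v ^+ q j)`_k.+1 = 0.
  move=> ji kq; rewrite coef_mul_size2 //.
  have [gj|gj] := eqVneq (g j v) 0.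
    by rewrite !G0 //; [ring | move: (q2 i); lia].
  rewrite (F0 _ _ 1%N) ?p1 // coef_affine_lineX bin_small; first by rewrite mulr0n; ring.
  by apply: leq_trans kq; rewrite ltn_neqAle q_neq //= imax.
have fvi x : (power_line (f i) (p i) x v)`_1 = 0.
  have := congr1 (fun P => P`_(q i).+1) (line_identity x v).
  rewrite coef0 coef_sum (bigD1 i) //= big1 ?addr0 => [|j ji]; last exact: term0.
  rewrite coef_mul_size2 // !coef_affine_lineX bin_small // binn subnn mulr0n mulr0.
  rewrite add0r mul1r mulr1n => /eqP; rewrite mulf_eq0 expf_eq0 (negPf gv) andbF orbF.
  by move/eqP.
have [x] := f_power_neq0 i; case/eqP.
have := congr1 (fun P => P`_(q i)) (line_identity x v).
rewrite coef0 coef_sum (bigD1 i) //= -(prednK (q_gt0 i)).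
rewrite big1 ?addr0 => [|j ji]; last by rewrite term0 // prednK.
rewrite coef_mul_size2 // fvi mul0r addr0 prednK // coef_affine_lineX binn subnn.
rewrite mul1r mulr1n coef_power_line bin0 subn0 mulr1 mulr1n => /eqP.
by rewrite mulf_eq0 expf_eq0 (negPf gv) andbF orbF => /eqP.
Qed.

(** As all [g j v] vanish, the coefficient of [t] differentiates only the [f] factors, and at most
    one index has [p i = 1]. *)
Lemma f_vanish v : (1 < n)%N ->
  (forall i, (1 < p i)%N -> annihilator (f i) v) -> forall i, f i v = 0.
Proof.
move=> n1 fv i; have gv := g_vanish n1 fv.
have [pi|pi] := ltnP 1 (p i); first by rewrite -[v]mulr1 fv.
have {}pi : p i = 1%N by move: pi (p_gt0 i); lia.
have [x gx] := g_neq0 i.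
have := congr1 (fun P => P`_1) (line_identity x v).
rewrite coef0 coef_sum (bigD1 i) //= big1 ?addr0 => [|j ji].
  rewrite /affine_line gv scale0r addr0 -rmorphXn coefMC coef_power_line pi.
  rewrite subnn mul1r expr1 mulr1n => /eqP.
  by rewrite mulf_eq0 expf_eq0 (negPf gx) andbF orbF => /eqP.
have pj : (1 < p j)%N.
  have : (i < j)%N || (j < i)%N by rewrite -neq_ltn eq_sym.
  by case/orP=> /p_incr; rewrite pi //; move: (p_gt0 j); lia.
rewrite /affine_line gv scale0r addr0 -rmorphXn coefMC coef_power_line expr1.
by rewrite [_ * v]mulrC fv // mul0rn mul0r.
Qed.

Lemma annihilator_all_algebraic : (1 < n)%N -> exists D, algebraic_mod annihilator_all D.
Proof.
move=> n1; have [|D algD] := @algebraic_mod_family (fun j => (1 < p j)%N)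
  (fun j => annihilator (f j)) (fun j => annihilator_ideal (f j)).
  by move=> j; apply: f_algebraic.
exists D => x; have [P [nzP szP fP]] := algD x; exists P; split=> // i b.
have fPb j : (1 < p j)%N -> annihilator (f j) (horner_alg x P * b).
  by move=> pj z; rewrite -mulrA; apply: fP.
by split; [apply: f_vanish | apply: g_vanish].
Qed.

End Equation.

(** * Degree at a point *)

Section BinomialPolynomials.
Variable K : numClosedFieldType.
Implicit Types (P : {poly K}).

Definition binomial_poly k : {poly K} :=
  (k`!%:R)^-1 *: \prod_(i < k) ('X - (i%:R)%:P).
Arguments binomial_poly : simpl never.

Lemma horner_binomial_poly k t : (binomial_poly k).[t%:R] = 'C(t, k)%:R.
Proof.
have nzk : k`!%:R != 0 :> K by rewrite pnatr_eq0 -lt0n fact_gt0.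
apply: (mulfI nzk); rewrite /binomial_poly hornerZ mulVKf // horner_prod.
rewrite -natrM mulnC bin_ffact ffact_prod natr_prod.
have [kt|tk] := leqP k t.
  by apply: eq_bigr => i _; rewrite !hornerE natrB // (leq_trans _ kt) // ltnW.
rewrite (bigD1 (Ordinal tk)) //= !hornerE subrr mul0r.
by rewrite (bigD1 (Ordinal tk)) //= subnn mul0r.
Qed.

Lemma size_binomial_poly k : size (binomial_poly k) = k.+1.
Proof.
rewrite size_scale ?invr_eq0 ?pnatr_eq0 -?lt0n ?fact_gt0 //.
by rewrite size_prod_XsubC /= /index_enum -enumT size_enum_ord.
Qed.

(** The binomial polynomials of degrees 1 to [r] span the polynomials of degree at most [r] without
    constant term. *)
Lemma binomial_poly_span (L : {scalar {poly K}}) r :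
  (forall k, (0 < k <= r)%N -> L (binomial_poly k) = 0) ->
  forall P, (size P <= r.+1)%N -> P.[0] = 0 -> L P = 0.
Proof.
move=> Lb; elim: r Lb => [|r IHr] Lb P szP P0.
  by rewrite (size1_polyC szP) in P0 *; rewrite hornerC in P0; rewrite P0 linear0.
pose c := P`_r.+1 / (binomial_poly r.+1)`_r.+1.
have nzl : (binomial_poly r.+1)`_r.+1 != 0.
  have := size_binomial_poly r.+1.
  by move=> szb; have := lead_coef_eq0 (binomial_poly r.+1);
     rewrite /lead_coef -size_poly_eq0 szb => ->.
rewrite -(subrK (c *: binomial_poly r.+1) P) linearD.
rewrite [L (_ *: _)]linearZ /= Lb ?ltnSn //.
rewrite mulr0 addr0; apply: IHr => [k /andP[k0 kr]||].
- by apply: Lb; rewrite k0 ltnW.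
- apply/leq_sizeP => j; rewrite leq_eqVlt => /orP[/eqP <-|jr].
    by rewrite coefB coefZ divfK ?subrr.
  by rewrite coefB coefZ !nth_default ?mulr0 ?subrr ?size_binomial_poly ?(leq_trans szP).
- by rewrite hornerD hornerN hornerZ P0 (horner_binomial_poly _ 0) mulr0 subr0.
Qed.

End BinomialPolynomials.

(** * Descent through the powers of the kernel of a character *)

Section Degree.
Variables (K : numClosedFieldType) (B : comAlgType K) (n N : nat).
Variables (p q : 'I_n -> nat) (f g : 'I_n -> {scalar B}).
Implicit Types (x y z u v a b : B) (i j : 'I_n) (P F : {poly K}).

Hypotheses (p_gt0 : forall i, (0 < p i)%N) (q_gt0 : forall i, (0 < q i)%N)
  (p_incr : forall i j, (i < j)%N -> (p i < p j)%N)
  (pqN : forall i, (p i + q i)%N = N) (p_lt_q : forall i j, i != j -> (p i < q j)%N)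
  (p_le_q : forall i, (p i <= q i)%N).
Hypotheses (f_neq0 : forall i, exists x, f i x != 0)
  (g_neq0 : forall i, exists x, g i x != 0)
  (fgE : forall x, \sum_(i < n) f i (x ^+ p i) * g i x ^+ q i = 0).
Hypothesis n_gt1 : (1 < n)%N.

Variables (phi : B -> K) (e : B) (D : nat).
Hypotheses (phiP : character phi)
  (eD : forall y, phi y = 0 -> annihilator_all f g (e * y ^+ D)).

Let phi1 : phi 1 = 1. Proof. by case: phiP. Qed.
Let phiD a b : phi (a + b) = phi a + phi b. Proof. by case: phiP. Qed.
Let phiM a b : phi (a * b) = phi a * phi b. Proof. by case: phiP. Qed.
Let phiZ k a : phi (k *: a) = k * phi a. Proof. by case: phiP. Qed.

Let phi_submodule : submodule (fun y => phi y = 0).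
Proof.
split=> [|c y z y0 z0]; first by rewrite -(scale0r 1) phiZ mul0r.
by rewrite phiD phiZ y0 z0 mulr0 addr0.
Qed.

Let phi_line t z : phi z = 0 -> phi (1 + t *: z) = 1.
Proof. by move=> z0; rewrite phiD phiZ z0 phi1 mulr0 addr0. Qed.

Let phiX x k : phi (x ^+ k) = phi x ^+ k.
Proof. by elim: k => [|k IH]; rewrite ?expr0 // !exprS phiM IH. Qed.

(** Single products generating [e M^m], with [M] the kernel of [phi]; sums are left out because only
    the vanishing of linear functionals matters. *)
Definition level m u := exists x (ys : seq B),
  [/\ size ys = m, forall y, y \in ys -> phi y = 0 & u = e * x * \prod_(y <- ys) y].

Lemma level_mul m u b : level m u -> level m (b * u).
Proof. by case=> x [ys [? ? ->]]; exists (b * x), ys; split=> //; ring. Qed.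

Lemma level_mulS m u y : phi y = 0 -> level m u -> level m.+1 (y * u).
Proof.
move=> y0 [x [ys [sz ysM ->]]]; exists x, (y :: ys); split=> /=; first by rewrite sz.
  by move=> z; rewrite inE => /orP[/eqP ->|/ysM].
by rewrite big_cons; ring.
Qed.

Lemma level_leq m m' u : (m' <= m)%N -> level m u -> level m' u.
Proof.
move=> mm [x [ys [sz ysM ->]]]; exists (x * \prod_(y <- drop m' ys) y), (take m' ys).
split; first by rewrite size_take sz; case: ltnP => //; lia.
  by move=> y /mem_take/ysM.
by rewrite -{1}(cat_take_drop m' ys) big_cat /=; ring.
Qed.

Lemma level_split k m u : level (k + m) u ->
  exists v (ys : seq B), [/\ level m v, size ys = k, forall y, y \in ys -> phi y = 0
    & u = v * \prod_(y <- ys) y].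
Proof.
case=> x [ys [sz ysM ->]].
exists (e * x * \prod_(y <- drop k ys) y), (take k ys); split.
- exists x, (drop k ys); split=> //; first by rewrite size_drop sz addKn.
  by move=> y /mem_drop/ysM.
- by rewrite size_take sz; case: ltnP => //; lia.
- by move=> y /mem_take/ysM.
by rewrite -{1}(cat_take_drop k ys) big_cat /=; ring.
Qed.

Lemma level_phi m u : (0 < m)%N -> level m u -> phi u = 0.
Proof.
move=> m0 [x [[|y ys] [sz ysM ->]]]; first by rewrite -sz in m0.
by rewrite big_cons !phiM (ysM y) ?mem_head // mul0r mulr0.
Qed.

Lemma level_exp m u k : (0 < m)%N -> (1 < k)%N -> level m u -> level m.+1 (u ^+ k).
Proof.
move=> m0 k1 Lu; rewrite -(subnK k1) exprD; apply: level_mul.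
by rewrite expr2; apply: level_mulS (level_phi m0 Lu) Lu.
Qed.

Lemma level_top u : level D u -> annihilator_all f g u.
Proof.
case=> x [ys [sz ysM ->]] i b.
have JM (h : {scalar B}) : (forall y, phi y = 0 -> forall b, h (e * y ^+ D * b) = 0) ->
    h (e * x * \prod_(y <- ys) y * b) = 0.
  move=> hD; have -> : e * x * \prod_(y <- ys) y * b = e * x * b * \prod_(y <- ys) y.
    by ring.
  apply: (polarization (h := shift (e * x * b) h) phi_submodule _ sz ysM) => y y0.
  rewrite -[LHS]/(h (_ * _)).
  have -> : e * x * b * y ^+ D = e * y ^+ D * (x * b) by ring.
  exact: hD.
by split; apply: JM => y y0 b'; case: (eD y0 i b').
Qed.

(** The negation says that [g i] is a multiple of [phi], see [untwistedE]. *)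
Definition twisted i := exists y, phi y = 0 /\ g i y != 0.

Lemma untwistedE i x : ~ twisted i -> g i x = g i 1 * phi x.
Proof.
move=> ntw; have gM y : phi y = 0 -> g i y = 0.
  by move=> y0; apply/eqP/contraT => gy; case: ntw; exists y.
have: g i (x - phi x *: 1) = 0.
  by apply: gM; rewrite -scaleN1r phiD !phiZ phi1; ring.
by rewrite linearB linearZ /= mulrC => /eqP; rewrite subr_eq0 => /eqP.
Qed.

Lemma untwisted_neq0 i : ~ twisted i -> g i 1 != 0.
Proof.
move=> ntw; have [x] := g_neq0 i; rewrite untwistedE //.
by rewrite mulf_eq0 negb_or => /andP[].
Qed.

Definition vanishing m :=
  forall u, level m u -> forall i, g i u = 0 /\ (twisted i -> f i u = 0).

(** Modulo the next level [x] acts on [u] as the scalar [phi x], and [u ^+ k] for [k > 1] already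
    lies in that level. *)
Lemma twisted_power_line m u j x : (0 < m)%N -> vanishing m.+1 -> level m u ->
  twisted j ->
  (power_line (f j) (p j) x u)`_1 = phi x ^+ (p j).-1 * f j u *+ p j /\
  forall k, (1 < k)%N -> (power_line (f j) (p j) x u)`_k = 0.
Proof.
move=> m0 vS Lu tw; split=> [|k k1]; rewrite coef_power_line; last first.
  by have [_ ->] := vS _ (level_mul (x ^+ (p j - k)) (level_exp m0 k1 Lu)) j; rewrite ?mul0rn.
rewrite bin1 expr1 subn1; congr (_ *+ _); set k := (p j).-1.
have: f j ((x ^+ k - phi x ^+ k *: 1) * u) = 0.
  apply: (vS _ (level_mulS _ Lu) j).2 => //.
  by rewrite -scaleN1r phiD !phiZ phi1 phiX; ring.
rewrite mulrBl linearB /= -scalerAl mul1r linearZ /= => /eqP.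
by rewrite subr_eq0 => /eqP.
Qed.

Let qN := q_neq p_incr pqN.
Let q2 j := q_gt1 p_gt0 p_incr pqN p_le_q j n_gt1.
Let lineE := line_identity fgE.

(* Substituting x + s u, a component with g_i(u) <> 0 and q_i maximal would have
   to be cancelled, through the coefficients of s^(q_i + 1), s^q_i and
   s^(q_i - 1), by the one with exponent q_l = q_i - 1; this makes f_l(x^p_l)
   affine along 1 + t z for phi z = 0, so f_l vanishes at u. *)
Lemma vanishing_g m u : (1 < m)%N -> vanishing m.+1 -> level m u -> forall i, g i u = 0.
Proof.
move=> m1 vS Lu i1; have m0 := ltnW m1; have phiu := level_phi m0 Lu.
apply/eqP/contraT => gu1.
case: (@arg_maxnP _ i1 (fun i => g i u != 0) q gu1) => i gu imax_.
have imax j : g j u != 0 -> (q j <= q i)%N := imax_ j.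
have tw j : g j u != 0 -> twisted j by move=> gj; exists u.
pose F j x := power_line (f j) (p j) x u.
pose L j x := affine_line (g j) x u ^+ q j.
have F1 j x : g j u != 0 -> (F j x)`_1 = phi x ^+ (p j).-1 * f j u *+ p j.
  by move=> /tw /(twisted_power_line x m0 vS Lu)[].
have F2 j x k : twisted j -> (1 < k)%N -> (F j x)`_k = 0.
  by move=> /(twisted_power_line x m0 vS Lu)[_]; apply.
have FL j x k : g j u != 0 ->
    (F j x * L j x)`_k.+1 = (F j x)`_0 * (L j x)`_k.+1 + (F j x)`_1 * (L j x)`_k.
  by move=> /tw twj; apply/coef_mul_size2/leq_sizeP => ?; apply: F2.
have Lk j x k : (q j < k)%N -> (L j x)`_k = 0.
  by move=> qk; rewrite coef_affine_lineX bin_small.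
have Ltop j x : (L j x)`_(q j) = g j u ^+ q j.
  by rewrite coef_affine_lineX subnn binn mulr1n mul1r.
have term0 j x k : g j u = 0 -> (1 < k)%N -> (~ twisted j -> p j < k)%N ->
    (F j x * L j x)`_k = 0.
  move=> gj k1 pk; rewrite /L /affine_line gj scale0r addr0 -rmorphXn coefMC.
  case: (pselect (twisted j)) => [twj|/pk pj]; first by rewrite F2 ?mul0r.
  by rewrite coef_power_line bin_small ?mulr0n ?mul0r.
have q1 := q2 i.
have fui x : (F i x)`_1 = 0.
  have := congr1 (fun P => P`_(q i).+1) (lineE x u).
  rewrite coef0 coef_sum (bigD1 i) //= big1 ?addr0 => [|j ji].
    rewrite -/(F i x) -/(L i x) FL // Lk // Ltop mulr0 add0r => /eqP.
    by rewrite mulf_eq0 expf_eq0 (negPf gu) andbF orbF => /eqP.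
  rewrite -/(F j x) -/(L j x); have [gj|gj] := eqVneq (g j u) 0.
    by apply: term0 => // [|_]; [lia | apply/leqW/p_lt_q].
  have qj : (q j < q i)%N by rewrite ltn_neqAle qN // imax.
  by rewrite FL // !Lk ?mulr0 ?addr0 // ltnW.
(* At degree [q i], besides [i], only a linear coefficient paired with the leading one of exponent
   [q i - 1] survives. *)
pose next j := [&& j != i, g j u != 0 & (q j).+1 == q i].
have coef_q x : (F i x)`_0 * g i u ^+ q i +
    \sum_(j | next j) (F j x)`_1 * g j u ^+ q j = 0.
  have := congr1 (fun P => P`_(q i)) (lineE x u).
  rewrite coef0 coef_sum (bigD1 i) //= -/(F i x) -/(L i x) => E.
  rewrite -[RHS]E; congr (_ + _).
    rewrite -{2}(prednK (q_gt0 i)) FL // fui mul0r addr0.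
    by rewrite prednK // Ltop.
  rewrite [RHS](bigID (fun j => next j)) /= [X in _ = _ + X]big1 ?addr0 => [|j].
    apply: eq_big => [j|j /and3P[ji gj /eqP qj]].
      by rewrite /next; case: (j != i).
    rewrite -/(F j x) -/(L j x) -qj FL // Ltop Lk //.
    by rewrite mulr0 add0r.
  case/andP=> ji; rewrite /next ji /= negb_and => nj.
  rewrite -/(F j x) -/(L j x); have [gj|gj] := eqVneq (g j u) 0.
    by apply: term0 => // _; apply: p_lt_q.
  rewrite gj /= in nj; have := imax _ gj; have := qN ji => qn ql.
  rewrite -(prednK (q_gt0 i)) FL // !Lk ?mulr0 ?addr0 //;
    by move: nj qn ql; lia.
have [l nl ful] : exists2 l, next l & f l u != 0.
  apply: contrapT => nex; have [x] := f_power_neq0 p_gt0 f_neq0 i; case/eqP.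
  move: (coef_q x); rewrite big1 => [|j nj].
    rewrite addr0 coef_power_line bin0 subn0 mulr1 mulr1n => /eqP.
    by rewrite mulf_eq0 expf_eq0 (negPf gu) andbF orbF => /eqP.
  have [_ gj _] := and3P nj; rewrite F1 //.
  suff -> : f j u = 0 by rewrite mulr0 mul0rn mul0r.
  by apply/eqP/contraT => fj; case: nex; exists j.
have [li gl /eqP ql] := and3P nl; have ql1 := q2 l.
have pl : (1 < p l)%N by move: (pqN i) (pqN l) (p_gt0 i); lia.
have twl := tw l gl.
(* For [phi x = 1] these contributions do not depend on [x]: [C1] is all but index [i] at degree
   [q i], [C2] all but [i] and [l] at degree [q l]. *)
pose C1 := \sum_(j | next j) f j u *+ p j * g j u ^+ q j.
pose C2 := \sum_(j | (j != i) && (j != l))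
  (if (q j).+1 == q l then f j u *+ p j * g j u ^+ q j else 0).
have coef_q1 x : phi x = 1 -> (F i x)`_0 * g i u ^+ q i + C1 = 0 /\
   (F i x)`_0 * (g i x * g i u ^+ q l *+ q i) +
   ((F l x)`_0 * g l u ^+ q l + f l u *+ p l * (g l x * g l u ^+ (q l).-1 *+ q l)) +
   C2 = 0.
  move=> phix; split.
    rewrite -[RHS](coef_q x); congr (_ + _); apply: eq_bigr => j /and3P[_ gj _].
    by rewrite F1 // phix expr1n mul1r.
  have := congr1 (fun P => P`_(q l)) (lineE x u).
  rewrite coef0 coef_sum (bigD1 i) //= (bigD1 l) //= => E.
  rewrite -[RHS]E -addrA; congr (_ + (_ + _)).
  - rewrite -/(F i x) -/(L i x) -{2}(prednK (q_gt0 l)) FL //.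
    rewrite fui mul0r addr0 prednK // coef_affine_lineX -ql subSn // subnn expr1.
    by rewrite binSn.
  - rewrite -/(F l x) -/(L l x) -{4}(prednK (q_gt0 l)) FL //.
    rewrite prednK // Ltop F1 // phix expr1n mul1r coef_affine_lineX.
    have -> : (q l - (q l).-1 = 1)%N by move: ql1; lia.
    by rewrite expr1 -[X in 'C(X, _)](prednK (q_gt0 l)) binSn prednK.
  apply: eq_bigr => j /andP[ji jl]; rewrite -/(F j x) -/(L j x).
  have [gj|gj] := eqVneq (g j u) 0.
    rewrite term0 ?gj //; first by rewrite expr0n (gtn_eqF (q_gt0 j)) mulr0 if_same.
    by move=> ntw; apply: p_lt_q.
  have := imax _ gj; have := qN ji; have := qN jl => q3 q4 q5.
  rewrite -(prednK (q_gt0 l)) FL // eqSS.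
  rewrite [X in _ * X + _]Lk ?mulr0 ?add0r; last by move: q3 q4 q5; lia.
  rewrite F1 // phix expr1n mul1r; case: eqP => [<-|qj]; first by rewrite Ltop.
  by rewrite Lk ?mulr0 //; move: q3 q4 q5 qj; lia.
(* By the first part of [coef_q1], [f i (x ^+ p i)] is the constant [A] on [1 + ker phi]. In the
   second, only the [p l]-th power is then not affine in [t], and its coefficient of [t^2] isolates
   [f l (z ^+ 2)], as [p l > 1]. *)
case/eqP: ful; have fz z : phi z = 0 -> f l (z ^+ 2) = 0.
  move=> z0; pose A := - C1 / g i u ^+ q i.
  pose G : {poly K} := A *: (affine_line (g i) 1 z * (g i u ^+ q l *+ q i)%:P) +
    ((power_line (f l) (p l) 1 z) * (g l u ^+ q l)%:P +
     (f l u *+ p l) *: (affine_line (g l) 1 z * (g l u ^+ (q l).-1 *+ q l)%:P)) + C2%:P.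
  have: G = 0.
    apply: poly_eq0_horner => t; have phit := phi_line t z0.
    have [E1 E2] := coef_q1 _ phit.
    have EA : (F i (1 + t *: z))`_0 = A.
      apply: (mulIf (expf_neq0 (q i) gu)); rewrite divfK ?expf_neq0 //.
      by apply/eqP; rewrite -subr_eq0 opprK E1.
    have Fl : (F l (1 + t *: z))`_0 = f l ((1 + t *: z) ^+ p l).
      by rewrite coef_power_line bin0 subn0 mulr1.
    rewrite -[RHS]E2 EA Fl /G.
    rewrite !(horner_affine_line, horner_power_line, hornerD, hornerZ, hornerM, hornerC).
    by rewrite !mulrnAr.
  move/(congr1 (fun P => P`_2)).
  rewrite coef0 !(coefD, coefZ, coefMC, coefC, coefX, coef_power_line) /=.
  rewrite !(mulr0, mul0r, add0r, addr0) expr1n mul1r => /eqP.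
  rewrite mulf_eq0 expf_eq0 (negPf gl) andbF orbF mulrn_eq0 => /orP[|/eqP //].
  by rewrite -leqn0 leqNgt bin_gt0 pl.
(* As [m > 1], [u] is a product of two elements of [ker phi], so polarizing [fz] gives
   [f l u = 0]. *)
have [y1 [[|y2 ys] [Ly1 // [sz] ysM ->]]] : exists v (ys : seq B),
    [/\ level (m - 1) v, size ys = 1%N, forall y, y \in ys -> phi y = 0
      & u = v * \prod_(y <- ys) y].
  by apply: level_split; rewrite subnKC.
have phi1' : phi y1 = 0 by apply: level_phi Ly1; rewrite subn_gt0.
rewrite (size0nil sz) big_seq1.
have := polarization phi_submodule fz (ys := [:: y1; y2]) erefl.
rewrite !big_cons big_nil mulr1; apply=> y; rewrite !inE => /orP[] /eqP ->//.
by apply: ysM; rewrite mem_head.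
Qed.

Lemma derivative_identity u x : (forall i, g i u = 0) ->
  \sum_i f i (x ^+ (p i).-1 * u) *+ p i * g i x ^+ q i = 0.
Proof.
move=> gu; have := congr1 (fun P => P`_1) (lineE x u).
rewrite coef0 coef_sum => E; rewrite -[RHS]E; apply: eq_bigr => i _.
rewrite /affine_line gu scale0r addr0 -rmorphXn coefMC coef_power_line.
by rewrite expr1 bin1 subn1.
Qed.

(** Take a twisted [i] with [f i u != 0] and [q i] maximal, and [y] in [ker phi] with [g i y != 0].
    Along [1 + t *: y] an untwisted term of [derivative_identity] has degree at most
    [p j - 1 < q i], so degree [q i] leaves only index [i]. *)
Lemma vanishing_f m u : (0 < m)%N -> vanishing m.+1 -> level m u ->
  (forall i, g i u = 0) -> forall i, twisted i -> f i u = 0.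
Proof.
move=> m0 vS Lu gu i1 tw1; apply/eqP/contraT => fu1.
pose Q i := `[< twisted i >] && (f i u != 0).
have Q1 : Q i1 by rewrite /Q fu1 andbT; apply/asboolP.
case: (@arg_maxnP _ i1 Q q Q1) => i /andP[/asboolP twi fu] imax_.
have imax j : Q j -> (q j <= q i)%N := imax_ j.
have [y [y0 gy]] := twi.
pose T j : {poly K} := if `[< twisted j >] then f j u *+ p j *: affine_line (g j) 1 y ^+ q j
  else (g j 1 ^+ q j *+ p j) *: power_line (shift u (f j)) (p j).-1 1 y.
have: \sum_j T j = 0.
  apply: poly_eq0_horner => t; have phit := phi_line t y0.
  rewrite -[RHS](derivative_identity (1 + t *: y) gu) horner_sum.
  apply: eq_bigr => j _; rewrite /T; case: asboolP => twj.
    rewrite hornerZ horner_exp horner_affine_line; congr (_ * _).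
    have [+ _] := twisted_power_line (1 + t *: y) m0 vS Lu twj.
    by rewrite coef_power_line phit expr1n mul1r expr1 bin1 subn1.
  rewrite hornerZ horner_power_line (untwistedE (1 + t *: y) twj) phit mulr1.
  by rewrite shiftE [u * _]mulrC !mulrnAl [X in X *+ _]mulrC.
move/(congr1 (fun P => P`_(q i))); rewrite coef0 coef_sum (bigD1 i) //= big1 => [|j ji].
  rewrite addr0 /T asboolT // coefZ coef_affine_lineX subnn binn mulr1n mul1r => /eqP.
  rewrite mulf_eq0 expf_eq0 (negPf gy) andbF orbF mulrn_eq0 (negPf fu) orbF.
  by rewrite (gtn_eqF (p_gt0 i)).
rewrite /T; case: asboolP => twj.
  have [->|fj] := eqVneq (f j u) 0; first by rewrite mul0rn scale0r coef0.
  have qj : (q j <= q i)%N by apply: imax; rewrite /Q fj andbT; apply/asboolP.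
  by rewrite coefZ coef_affine_lineX bin_small ?mulr0n ?mulr0 // ltn_neqAle qN.
rewrite coefZ coef_power_line bin_small ?mulr0n ?mulr0 //.
by move: (p_lt_q ji) (p_gt0 j); lia.
Qed.

Lemma vanishing2 : vanishing 2.
Proof.
(* The descent from level [D] stops at 2 because [vanishing_g] needs [m > 1]. *)
suff: forall k, vanishing (maxn 2 (D - k)).
  by move/(_ D); rewrite subnn.
elim=> [|k IHk].
  move=> u Lu i; have /level_top/(_ i 1) : level D u.
    by apply: level_leq Lu; rewrite subn0 leq_maxr.
  by rewrite mulr1 => -[? ?]; split.
have [Dk|kD] := leqP (D - k) 2.
  by rewrite (_ : maxn 2 (D - k.+1) = maxn 2 (D - k))%N //; lia.
set m := maxn 2 (D - k.+1); have m1 : (1 < m)%N by rewrite /m; lia.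
have {}IHk : vanishing m.+1.
  by rewrite (_ : m.+1 = maxn 2 (D - k))%N // /m; lia.
move=> u Lu i; have gu := vanishing_g m1 IHk Lu; split=> //.
exact: vanishing_f (ltnW m1) IHk Lu gu i.
Qed.

Definition untwisted_weight j : K := if `[< twisted j >] then 0 else g j 1 ^+ q j.

(** Along [1 + t *: y] the twisted terms of [derivative_identity] vanish and the untwisted [g j] are
    constant. The polarized coefficient of degree [k - 1] carries [p j] times ['C(p j - 1, k - 1)],
    which is [k] times ['C(p j, k)]. *)
Lemma untwisted_binomial m k v : (0 < m)%N -> (0 < k)%N ->
  (forall u, level m u -> forall i, g i u = 0 /\ (twisted i -> f i u = 0)) ->
  level (k.-1 + m) v -> \sum_j untwisted_weight j * f j v * 'C(p j, k)%:R = 0.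
Proof.
move=> m0 k0 van /level_split[u [ys [Lu sz ysM ->]]].
have gu i : g i u = 0 by case: (van u Lu i).
have vS : vanishing m.+1.
  by move=> w /(level_leq (leqnSn m)); apply: van.
pose h : {scalar B} := shifted_sum f
  (fun j => untwisted_weight j * (p j)%:R * 'C((p j).-1, k.-1)%:R) (fun=> u).
have hy y : phi y = 0 -> h (y ^+ k.-1) = 0.
  move=> y0.
  pose T : {poly K} := \sum_j (untwisted_weight j * (p j)%:R) *:
     power_line (shift u (f j)) (p j).-1 1 y.
  have: T = 0.
    apply: poly_eq0_horner => t; have phit := phi_line t y0.
    rewrite -[RHS](derivative_identity (1 + t *: y) gu) horner_sum.
    apply: eq_bigr => j _; rewrite hornerZ horner_power_line.
    rewrite shiftE [u * _]mulrC.
    rewrite /untwisted_weight; case: asboolP => twj; last first.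
      by rewrite (untwistedE (1 + t *: y) twj) phit mulr1 -mulr_natr; ring.
    have [+ _] := twisted_power_line (1 + t *: y) m0 vS Lu twj.
    rewrite coef_power_line phit expr1n mul1r expr1 bin1 subn1 => ->.
    by have [_ ->] := van u Lu j; rewrite // mul0rn !mul0r.
  move/(congr1 (fun P => P`_k.-1)); rewrite coef0 coef_sum => E.
  rewrite -[RHS]E; apply: eq_bigr => j _; rewrite coefZ coef_power_line expr1n mul1r.
  by rewrite shiftE -mulr_natr; ring.
have := polarization phi_submodule hy sz ysM.
set w := \prod_(y <- ys) y.
move/(congr1 (fun c => (k%:R)^-1 * c)); rewrite mulr0 => E.
rewrite -[RHS]E -[h w]/(\sum_j _) mulr_sumr; apply: eq_bigr => j _.
have nzk : k%:R != 0 :> K by rewrite pnatr_eq0 -lt0n.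
apply: (mulfI nzk); rewrite mulVKf //.
have Ek : (k%:R * 'C(p j, k)%:R = (p j)%:R * 'C((p j).-1, k.-1)%:R :> K).
  by rewrite -!natrM -[in LHS](prednK k0) -mul_bin_diag.
rewrite mulrCA Ek; ring.
Qed.

(** Vandermonde argument: [L] kills all polynomials of degree at most [r] without constant term, and
    at the product of ['X] with the ['X - p j] for the other untwisted [j] it retains only [j0]. *)
Lemma untwisted_vanish r v : (forall k, (0 < k <= r)%N ->
    \sum_j untwisted_weight j * f j v * 'C(p j, k)%:R = 0) ->
  (#|[pred j | ~~ `[< twisted j >]]| <= r)%N ->
  forall j, ~ twisted j -> f j v = 0.
Proof.
move=> E cr j0 ntw.
pose L (P : {poly K}) := \sum_j untwisted_weight j * f j v * P.[(p j)%:R].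
have linL : linear_for *%R L.
  move=> c P Q; rewrite /L mulr_sumr -big_split; apply: eq_bigr => j _ /=.
  by rewrite hornerD hornerZ; ring.
pose Ls : {scalar {poly K}} :=
  HB.pack L (GRing.isLinear.Build K {poly K} K *%R L linL).
have LsE P : Ls P = L P by [].
pose U := [pred j | ~~ `[< twisted j >] & j != j0].
pose P : {poly K} := \prod_(j in U) ('X - ((p j)%:R)%:P) * 'X.
have szP : (size P <= r.+1)%N.
  rewrite size_mulX ?monic_neq0 ?monic_prod_XsubC // -big_enum size_prod_XsubC -cardE.
  rewrite ltnS; apply: leq_trans cr.
  rewrite [X in (_ <= X)%N](cardD1 j0) inE asboolF //= add1n ltnS.
  by apply: subset_leq_card; apply/fintype.subsetP => j; rewrite !inE andbC.
have LP0 : L P = 0.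
  rewrite -LsE; apply: (@binomial_poly_span _ Ls r) => // [k kr|].
    rewrite LsE -[RHS](E k kr) /L; apply: eq_bigr => j _.
    by rewrite horner_binomial_poly.
  by rewrite hornerM hornerX mulr0.
move: LP0; rewrite /L (bigD1 j0) //= big1 => [|j jj0].
  rewrite addr0 /untwisted_weight asboolF // hornerM hornerX => /eqP.
  rewrite !mulf_eq0 expf_eq0 (negPf (untwisted_neq0 ntw)) andbF /=.
  rewrite pnatr_eq0 (gtn_eqF (p_gt0 j0)) orbF => /orP[/eqP //|].
  rewrite horner_prod => /prodf_eq0[j]; rewrite !inE => /andP[_ jj0].
  rewrite !hornerE subr_eq0 eqr_nat => /eqP pj.
  have : (j0 < j)%N || (j < j0)%N by rewrite -neq_ltn eq_sym.
  by case/orP=> /p_incr; rewrite pj ltnn.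
rewrite /untwisted_weight; case: asboolP => twj; first by rewrite !mul0r.
rewrite [X in _ * X](_ : _ = 0) ?mulr0 //; apply/rootP.
rewrite /P rootM /root horner_prod (bigD1 j) /=; last by rewrite !inE asboolF.
by rewrite !hornerE subrr mul0r eqxx.
Qed.

(** With a twisted index at most [n - 1] indices are untwisted, so [k < n] suffices and [m = 2]
    fits: [k - 1 + 2 <= n]. With none, [k] runs up to [n], but every [g j] is a multiple of [phi]
    and [m = 1] is allowed. *)
Theorem local_degree u : level n u -> forall i, f i u = 0 /\ g i u = 0.
Proof.
move=> Lu; have L2 : level 2 u := level_leq n_gt1 Lu.
suff ntwf i : ~ twisted i -> f i u = 0.
  move=> i; have [gu fu] := vanishing2 L2 i; split=> //.
  by case: (pselect (twisted i)) => [/fu|/ntwf].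
case: (pselect (exists i, twisted i)) => [[i0 tw0]|ntw].
  apply: (@untwisted_vanish n.-1) => [k /andP[k0 kn]|].
    apply: (@untwisted_binomial 2) => //; first exact: vanishing2.
    by apply: level_leq Lu; move: n_gt1; lia.
  have := cardC [pred j | `[< twisted j >]]; rewrite card_ord => E.
  apply: (@leq_trans (#|[pred j | `[< twisted j >]]| + #|[predC [pred j | `[< twisted j >]]]|).-1);
    last by rewrite E.
  rewrite [X in (_ <= (X + _).-1)%N](cardD1 i0) inE asboolT //=.
  exact: leq_addl.
apply: (@untwisted_vanish n) => [k /andP[k0 kn]|]; last first.
  by rewrite -[X in (_ <= X)%N]card_ord max_card.
apply: (@untwisted_binomial 1) => // [v Lv j|].
  split=> [|twj]; last by case: ntw; exists j.
  by rewrite untwistedE ?(level_phi _ Lv) ?mulr0 // => twj; case: ntw; exists j.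
by apply: level_leq Lu; move: kn k0; lia.
Qed.

End Degree.

(** * Generalized exponential polynomials *)

Section TruncatedLogarithm.
Variables (K : numClosedFieldType) (r : nat).

(* The coefficient of t in 'C(t, k), i.e. (-1)^(k-1)/k for k > 0. *)
Definition log_coef k : K := (binomial_poly K k)`_1.

Definition log_poly : {poly K} := \poly_(k < r.+1) log_coef k.

Definition exp_log_poly : {poly K} := \sum_(k < r.+1) (k`!%:R)^-1 *: log_poly ^+ k.

Lemma binomial_poly_coef0 k : (binomial_poly K k)`_0 = (k == 0)%:R.
Proof. by rewrite -horner_coef0 (horner_binomial_poly K k 0) bin0n eq_sym. Qed.

Lemma binomial_polyS k : k.+1%:R *: binomial_poly K k.+1 =
  binomial_poly K k * ('X - (k%:R)%:P).
Proof.
rewrite /binomial_poly big_ord_recr /= scalerA -scalerAl; congr (_ *: _).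
by rewrite factS natrM invfM mulVKf // pnatr_eq0.
Qed.

Lemma log_coef0 : log_coef 0 = 0.
Proof. by rewrite /log_coef /binomial_poly big_ord0 coefZ coefC mulr0. Qed.

(** Coefficientwise, this is the differential equation [(1 + X) L' = 1] of [L = log(1 + X)]. *)
Lemma log_coefS k : k.+1%:R * log_coef k.+1 + k%:R * log_coef k = (k == 0)%:R.
Proof.
have := congr1 (fun P : {poly K} => P`_1) (binomial_polyS k).
rewrite coefZ mulrBr coefB coefMX coefMC /= binomial_poly_coef0 -/(log_coef _) => ->.
by rewrite mulrC subrK.
Qed.

Lemma coef_log_poly k : (k <= r)%N -> log_poly`_k = log_coef k.
Proof. by move=> kr; rewrite coef_poly ltnS kr. Qed.

Lemma log_poly_expX k : exists P, log_poly ^+ k = P * 'X^k.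
Proof.
have /factor_theorem[P EP] : root log_poly 0.
  by rewrite /root horner_coef0 coef_log_poly // log_coef0.
by exists (P ^+ k); rewrite EP subr0 exprMn.
Qed.

(* Both sides solve (1 + X) E' = E up to order r, with the same constant term. *)
Lemma coef_exp_log j : (j <= r)%N -> exp_log_poly`_j = (1 + 'X : {poly K})`_j.
Proof.
have E0 : exp_log_poly`_0 = 1.
  rewrite /exp_log_poly coef_sum big_ord_recl coefZ expr0 coefC invr1 mul1r.
  rewrite big1 ?addr0 // => k _; have [P ->] := log_poly_expX (lift ord0 k).
  by rewrite coefZ coefMXn mulr0.
(* Differentiation loses the top term of the exponential, a multiple of ['X^r], so [E'] agrees with
   [exp_log_poly] below degree [r]. *)
pose E' : {poly K} := \sum_(k < r) (k`!%:R)^-1 *: log_poly ^+ k.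
have EE' i : (i < r)%N -> E'`_i = exp_log_poly`_i.
  move=> ir; rewrite /exp_log_poly big_ord_recr coefD -/E' coefZ /=.
  by have [P ->] := log_poly_expX r; rewrite coefMXn ir mulr0 addr0.
have dE : exp_log_poly^`() = log_poly^`() * E'.
  rewrite /exp_log_poly raddf_sum big_ord_recl /= expr0 derivZ derivC scaler0 add0r.
  rewrite mulr_sumr; apply: eq_bigr => k _.
  rewrite derivZ deriv_exp /bump /= add1n -scaler_nat scalerA -scalerAr.
  congr (_ *: _); have nz : k.+1%:R != 0 :> K by rewrite pnatr_eq0.
  by rewrite factS natrM invfM mulrAC mulVf // mul1r.
have rec i : (i < r)%N ->
    i.+1%:R * exp_log_poly`_i.+1 + i%:R * exp_log_poly`_i = exp_log_poly`_i.
  move=> ir; have dL k : (k < r)%N -> ((1 + 'X) * log_poly^`())`_k = (k == 0)%:R.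
    move=> kr; rewrite mulrDl mul1r coefD coefXM !coef_deriv coef_log_poly //.
    case: k kr => [|k] kr /=; first by have := log_coefS 0; rewrite mul1r mul0r mulr1n.
    by rewrite coef_log_poly ?(ltnW kr) //; have := log_coefS k.+1; rewrite !mulr_natl.
  have Ei : ((1 + 'X) * exp_log_poly^`())`_i = exp_log_poly`_i.
    rewrite dE mulrA coefM big_ord_recl big1 => [|k _]; last first.
      by rewrite dL ?mul0r //; apply: leq_trans (ltn_ord (lift ord0 k)) ir.
    by rewrite dL ?(leq_ltn_trans _ ir) // mul1r addr0 subn0 EE'.
  rewrite -[RHS]Ei mulrDl mul1r coefD coefXM !coef_deriv -[in RHS]mulr_natl.
  by congr (_ + _); case: i ir {Ei} => [|i] ir /=; rewrite ?mul0r // mulr_natl.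
elim: j => [|j IHj] jr; first by rewrite E0 coefD coefC coefX addr0.
have nz : j.+1%:R != 0 :> K by rewrite pnatr_eq0.
apply: (mulfI nz); apply: (addIr (j%:R * exp_log_poly`_j)); rewrite rec //.
rewrite IHj ?(ltnW jr) // !coefD !coefC !coefX.
by case: j {nz IHj jr} => [|[|j]] /=; ring.
Qed.

Lemma exp_log_polyE : exists P, exp_log_poly = 1 + 'X + P * 'X^(r.+1).
Proof.
exists (drop_poly r.+1 (exp_log_poly - (1 + 'X))).
apply/eqP; rewrite addrC -subr_eq; apply/eqP.
rewrite -[LHS](poly_take_drop r.+1) (_ : take_poly _ _ = 0) ?add0r //.
apply/polyP => j; rewrite coef_take_poly coef0 ltnS; case: leqP => // jr.
by rewrite coefB coef_exp_log // subrr.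
Qed.

End TruncatedLogarithm.

Section GeneralizedPolynomial.
Variables (K : numClosedFieldType) (B : comAlgType K) (G : groupType) (r : nat).
Variables (h : {scalar B}) (phi : B -> K) (X : G -> B).
Hypotheses (phiP : character phi) (phiX : forall a, phi (X a) = 1)
  (h_nil : forall x (ys : seq B), size ys = r.+1 -> (forall y, y \in ys -> phi y = 0) ->
     h (x * \prod_(y <- ys) y) = 0)
  (XM : forall a b z, h (X (a * b)%g * z) = h (X a * X b * z)).

Let eta a := X a - 1.

Let phi_eta a : phi (eta a) = 0.
Proof.
have [phi1 phiD _ phiZ] := phiP.
by rewrite /eta -scaleN1r phiD phiX phiZ phi1 mulr1 subrr.
Qed.

Let h_etaX z y k : phi y = 0 -> (r < k)%N -> h (z * y ^+ k) = 0.
Proof.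
move=> y0 rk; rewrite -(subnK rk) exprD mulrA.
have -> : y ^+ r.+1 = \prod_(x <- nseq r.+1 y) x by rewrite big_nseq iter_mulr_1.
by apply: h_nil => [|x]; rewrite ?size_nseq // mem_nseq => /andP[_ /eqP ->].
Qed.

Lemma truncated_binomial z y t : phi y = 0 ->
  h (z * (1 + y) ^+ t) = \sum_(k < r.+1) 'C(t, k)%:R * h (z * y ^+ k).
Proof.
move=> y0; pose F k := 'C(t, k)%:R * h (z * y ^+ k).
have -> : h (z * (1 + y) ^+ t) = \sum_(k < t.+1) F k.
  rewrite exprDn mulr_sumr raddf_sum; apply: eq_bigr => k _ /=.
  by rewrite expr1n mul1r mulrnAr raddfMn /= -mulr_natl.
rewrite -[LHS](big_mkord xpredT F) -[RHS](big_mkord xpredT F).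
have [tr|rt] := leqP t r.
  rewrite [RHS](@big_cat_nat _ _ _ t.+1) //= [X in _ = _ + X]big_nat_cond.
  rewrite [X in _ = _ + X]big1 ?addr0 // => k /andP[/andP[tk _] _].
  by rewrite /F bin_small // mul0r.
rewrite [LHS](@big_cat_nat _ _ _ r.+1) //=; last exact: ltnW.
rewrite [X in _ + X = _]big_nat_cond [X in _ + X = _]big1 ?addr0 // => k.
by case/andP=> /andP[rk _] _; rewrite /F h_etaX ?mulr0.
Qed.

Definition group_log a := horner_alg (eta a) (log_poly K r).

Lemma group_logE z a :
  h (z * group_log a) = \sum_(k < r.+1) log_coef K k * h (z * eta a ^+ k).
Proof.
rewrite /group_log /log_poly poly_def raddf_sum mulr_sumr raddf_sum.
apply: eq_bigr => k _ /=.
by rewrite -mul_polyC horner_algM horner_algC rmorphXn /= horner_algX mulr_algl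
  -scalerAr linearZ.
Qed.

Lemma XMX z a b t : h (z * X (a * b)%g ^+ t) = h (z * (X a ^+ t * X b ^+ t)).
Proof.
elim: t z => [|t IH] z; first by rewrite !expr0 mul1r.
rewrite !exprS mulrCA XM.
have -> : X a * X b * (z * X (a * b)%g ^+ t) = X a * X b * z * X (a * b)%g ^+ t by ring.
by rewrite IH; congr (h _); ring.
Qed.

(** By [truncated_binomial], both sides of [XMX] are polynomials in the natural number [t], hence
    equal as polynomials. Their coefficients of [t] are the two sides here: a product of two
    binomials has a linear term only if one of them is constant. *)
Lemma group_logM z a b :
  h (z * group_log (a * b)%g) = h (z * group_log a) + h (z * group_log b).
Proof.
pose T1 : {poly K} := \sum_(k < r.+1) h (z * eta (a * b)%g ^+ k) *: binomial_poly K k.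
pose T2 : {poly K} := \sum_(k < r.+1) \sum_(l < r.+1)
  h (z * eta a ^+ k * eta b ^+ l) *: (binomial_poly K k * binomial_poly K l).
have X1 c : X c = 1 + eta c by rewrite /eta addrC subrK.
have T12 : T1 - T2 = 0.
  apply: poly_eq0_nat => t; rewrite hornerD hornerN; apply/eqP; rewrite subr_eq0; apply/eqP.
  transitivity (h (z * X (a * b)%g ^+ t)).
    rewrite X1 truncated_binomial // horner_sum; apply: eq_bigr => k _.
    by rewrite hornerZ horner_binomial_poly mulrC.
  rewrite XMX mulrCA X1 mulrC truncated_binomial // horner_sum.
  apply: eq_bigr => k _; rewrite horner_sum X1.
  have -> : z * (1 + eta b) ^+ t * eta a ^+ k = z * eta a ^+ k * (1 + eta b) ^+ t by ring.
  rewrite truncated_binomial // mulr_sumr; apply: eq_bigr => l _.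
  by rewrite hornerZ hornerM !horner_binomial_poly; ring.
have coef1 k l : (binomial_poly K k * binomial_poly K l)`_1 =
    (k == 0)%:R * log_coef K l + log_coef K k * (l == 0)%:R.
  by rewrite coefM !big_ord_recl big_ord0 /= addr0 !binomial_poly_coef0.
have := congr1 (fun P : {poly K} => P`_1) T12.
rewrite coefB coef0 => /eqP; rewrite subr_eq0 => /eqP; rewrite /T1 /T2 !coef_sum => E.
transitivity (\sum_(i < r.+1) (h (z * eta (a * b)%g ^+ i) *: binomial_poly K i)`_1).
  by rewrite group_logE; apply: eq_bigr => k _; rewrite coefZ mulrC.
rewrite E !group_logE big_ord_recl [X in _ + X = _](_ : _ =
  \sum_(k < r) log_coef K (lift ord0 k) * h (z * eta a ^+ lift ord0 k)); last first.
  apply: eq_bigr => k _; rewrite coef_sum big_ord_recl big1 => [|l _].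
    by rewrite coefZ coef1 expr0 mulr1 addr0 /= mul0r add0r mulr1 mulrC.
  by rewrite coefZ coef1 /= mul0r mulr0 addr0 mulr0.
rewrite [in RHS]big_ord_recl /= log_coef0 mul0r add0r addrC; congr (_ + _).
rewrite coef_sum; apply: eq_bigr => l _.
by rewrite coefZ coef1 log_coef0 eqxx mul1r mul0r addr0 expr0 mulr1 mulrC.
Qed.

(** The form [A k] is [h] of the product of the logarithms over [k!]; summing on the diagonal gives
    the truncated exponential of [log (X a)], which [h] cannot distinguish from [X a]. *)
Lemma functional_gen_poly : gen_poly r (fun a => h (X a)).
Proof.
exists (fun k (x : {ffun 'I_k -> G}) => (k`!%:R)^-1 * h (\prod_(i < k) group_log (x i))).
split=> [k _|a].
  split=> [s x|i x a b].
    congr (_ * h _); rewrite [RHS](reindex_inj (@perm.perm_inj _ s)).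
    by apply: eq_bigr => i _; rewrite ffunE.
  rewrite -mulrDr; congr (_ * _).
  have E c : \prod_(j < k) group_log (set_coord x i c j) =
      \prod_(j < k | j != i) group_log (x j) * group_log c.
    rewrite (bigD1 i) //= ffunE eqxx mulrC; congr (_ * _).
    by apply: eq_bigr => j /negPf ji; rewrite ffunE ji.
  by rewrite !E group_logM.
transitivity (h (horner_alg (eta a) (exp_log_poly K r))).
  have [P ->] := exp_log_polyE K r.
  rewrite rmorphD rmorphM rmorphXn rmorphD rmorph1 /= horner_algX addrC.
  by rewrite [1 + _]addrC subrK linearD /= h_etaX // add0r.
rewrite /exp_log_poly !raddf_sum; apply: eq_bigr => k _ /=.
rewrite -mul_polyC horner_algM horner_algC mulr_algl linearZ /=; congr (_ * h _).
rewrite rmorphXn /= -/(group_log a).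
by under eq_bigr do rewrite ffunE; rewrite prodr_const card_ord.
Qed.

End GeneralizedPolynomial.

(** The partition [c] splits [h (X a)] over the points; dividing [X a] by the exponential
    [phi j (X a)] normalizes it for [functional_gen_poly]. *)
Lemma gen_exp_poly_points (K : numClosedFieldType) (B : comAlgType K) (G : groupType)
    (r m : nat) (h : {scalar B}) (X : G -> B) (c : 'I_m -> B) (phi : 'I_m -> B -> K) :
  (forall b, h ((1 - \sum_(j < m) c j) * b) = 0) ->
  (forall a b z, h (X (a * b)%g * z) = h (X a * X b * z)) ->
  (forall j, character (phi j)) -> (forall j a, phi j (X a) != 0) ->
  (forall j a b, phi j (X (a * b)%g) = phi j (X a) * phi j (X b)) ->
  (forall j x (ys : seq B), size ys = r.+1 -> (forall y, y \in ys -> phi j y = 0) ->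
     h (c j * x * \prod_(y <- ys) y) = 0) ->
  gen_exp_poly r (fun a => h (X a)).
Proof.
move=> hc hX phiP phi_neq0 phiM h_nil.
pose Xh j a := (phi j (X a))^-1 *: X a.
exists m, (fun j a => h (c j * Xh j a)), (fun j a => phi j (X a)).
split=> [j|a]; last first.
  have := hc (X a); rewrite mulrBl mul1r linearB /= => /eqP.
  rewrite subr_eq0 => /eqP ->; rewrite mulr_suml raddf_sum; apply: eq_bigr => j _ /=.
  by rewrite /Xh -scalerAr linearZ /= mulrAC mulVf // mul1r.
split=> //; have [_ _ _ phiZ] := phiP j.
apply: (functional_gen_poly (h := shift (c j) h) (phiP j)) => [a|x ys sz ysM|a b z].
- by rewrite /Xh phiZ mulVf.
- by rewrite shiftE mulrA; apply: h_nil.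
rewrite !shiftE /Xh phiM invfM; set s := (phi j (X a))^-1.
set t := (phi j (X b))^-1; move: s t => s t.
have -> : c j * ((s * t) *: X (a * b)%g * z) = (s * t) *: (X (a * b)%g * (c j * z)).
  by rewrite -scalerAl -scalerAr mulrCA.
have -> : c j * (s *: X a * (t *: X b) * z) = (s * t) *: (X a * X b * (c j * z)).
  by rewrite -!(scalerAl, scalerAr) scalerA mulrCA.
by rewrite ![h (_ *: _)]linearZ /= hX.
Qed.

Theorem algebra_gen_exp_poly (K : numClosedFieldType) (B : comAlgType K) (G : groupType)
    (X : G -> B) (n N : nat) (p q : 'I_n -> nat) (f g : 'I_n -> {scalar B}) :
  (0 < n)%N -> (forall i, (0 < p i)%N) -> (forall i, (0 < q i)%N) ->
  (forall i j : 'I_n, (i < j)%N -> (p i < p j)%N) ->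
  (forall i, (p i + q i)%N = N) ->
  (forall i j : 'I_n, i != j -> (p i < q j)%N) -> (forall i, (p i <= q i)%N) ->
  (forall i, exists b, f i b != 0) -> (forall i, exists b, g i b != 0) ->
  (forall b, \sum_(i < n) f i (b ^+ p i) * g i b ^+ q i = 0) ->
  annihilator_all f g (X 1%g - 1) ->
  (forall a b, annihilator_all f g (X (a * b)%g - X a * X b)) ->
  forall i, gen_exp_poly n.-1 (fun a => f i (X a)) /\
            gen_exp_poly n.-1 (fun a => g i (X a)).
Proof.
move=> n0 p0 q0 p_incr pqN p_lt_q p_le_q fn0 gn0 fgE JX1 JXM.
have n1 := index_gt1 p0 q0 fn0 gn0 fgE n0.
have [D algJ] := annihilator_all_algebraic p0 q0 p_incr pqN p_le_q fn0 gn0 fgE n1.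
have [m [c [phi [Jc phiP]]]] := local_decomposition (annihilator_all_ideal f g) algJ.
have phiJ j b1 b2 : annihilator_all f g (b1 - b2) -> phi j b1 = phi j b2.
  have [[_ phiD _ _] phiJ _] := phiP j.
  by move=> Jb; rewrite -(subrK b2 b1) phiD phiJ // add0r.
have phiM j a b : phi j (X (a * b)%g) = phi j (X a) * phi j (X b).
  by rewrite (phiJ _ _ _ (JXM a b)); case: (phiP j) => [[_ _ phiM _] _ _].
have phi_neq0 j a : phi j (X a) != 0.
  apply/eqP => phi0; have := phiM j a a^-1%g; rewrite phi0 mul0r mulgV.
  rewrite (phiJ _ _ _ JX1); have [[-> _ _ _] _ _] := phiP j.
  by move/eqP; rewrite oner_eq0.
have main (h : {scalar B}) : (forall z b, annihilator_all f g z -> h (z * b) = 0) ->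
    (forall j u, level (phi j) (c j) n u -> h u = 0) ->
    gen_exp_poly n.-1 (fun a => h (X a)).
  move=> hJ h_nil; apply: (gen_exp_poly_points (c := c) (phi := phi)) => //.
  - by move=> b; apply: hJ.
  - by move=> a b z; apply/eqP; rewrite -subr_eq0 -linearB -mulrBl; apply/eqP/hJ.
  - by move=> j; have [] := phiP j.
  by move=> j x ys sz ysM; apply: (h_nil j); exists x, ys; rewrite sz prednK.
have deg j u : level (phi j) (c j) n u -> forall i, f i u = 0 /\ g i u = 0.
  move=> Lu; have [phic _ phinil] := phiP j.
  exact: (local_degree p0 q0 p_incr pqN p_lt_q p_le_q fn0 gn0 fgE n1 phic phinil Lu).
by move=> i; split; apply: main => [z b Jz|j u /deg/(_ i)[] //]; case: (Jz i b).
Qed.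

(** * The monoid algebra of [F] and extension of the identity to it *)

Section AdjoinedUnit.
Variable F : fieldType.

(* The multiplicative monoid of F with a new unit None adjoined: the monomials
   of monalg are required to have no invertible element but 1. *)
Definition unital := option F.

HB.instance Definition _ := Choice.copy unital (option F).

Definition unital_mul (u v : unital) : unital :=
  match u, v with
  | None, _ => v
  | _, None => u
  | Some a, Some b => Some (a * b)
  end.

Fact unital_mulA : associative unital_mul.
Proof. by move=> [a|] [b|] [c|] //=; rewrite mulrA. Qed.

Fact unital_mul1 : left_id None unital_mul.
Proof. by []. Qed.

Fact unital_mulr1 : right_id None unital_mul.
Proof. by case. Qed.

Fact unital_unit u v : unital_mul u v = None -> u = None /\ v = None.
Proof. by case: u v => [a|] [b|]. Qed.

Fact unital_mulC : commutative unital_mul.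
Proof. by move=> [a|] [b|] //=; rewrite mulrC. Qed.

HB.instance Definition _ := Choice_isMonomialDef.Build unital
  unital_mulA unital_mul1 unital_mulr1 unital_unit.
HB.instance Definition _ := MonomialDef_isConomialDef.Build unital unital_mulC.

Definition unital_val (u : unital) : F := if u is Some a then a else 1.

Lemma unital_valM u v : unital_val (mmul u v) = unital_val u * unital_val v.
Proof. by case: u v => [a|] [b|] //=; rewrite ?mul1r ?mulr1. Qed.

End AdjoinedUnit.

Section Extension.
Variables (K : numClosedFieldType) (F : fieldType).
Local Notation B := {malg K[unital F]}.
Implicit Types (h : F -> K) (b z : B) (x y : F) (u v : unital F).

Definition additive_fun h := forall x y, h (x + y) = h x + h y.

Definition extend h : B -> K := mmap idfun (h \o @unital_val F).

Fact extend_linear h : linear_for *%R (extend h).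
Proof.
move=> c b z; rewrite /extend mmapD; congr (_ + _).
rewrite (mmapEw (msuppZ_le _ _)) mmapE mulr_sumr.
by apply: eq_bigr => k _; rewrite mcoeffZ mulrA.
Qed.

HB.instance Definition _ h :=
  GRing.isLinear.Build K B K *%R (extend h) (extend_linear h).

Lemma extendU h u : extend h << u >> = h (unital_val u).
Proof. by rewrite /extend mmapU mul1r. Qed.

Lemma malgU_scale (c : K) u : << c *g u >> = c *: << u >> :> B.
Proof. by apply/malgP => k; rewrite mcoeffZ !mcoeffU mulrnAr mulr1. Qed.

Lemma malgU_mul u v : << u >> * << v >> = << mmul u v >> :> B.
Proof. by rewrite malgM_def fgmulUU mulr1. Qed.

Lemma scalar_malg_ext (l1 l2 : {scalar B}) :
  (forall u, l1 << u >> = l2 << u >>) -> forall z, l1 z = l2 z.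
Proof.
move=> l12 z; rewrite [z]monalgE !raddf_sum; apply: eq_bigr => u _ /=.
by rewrite malgU_scale !linearZ /= l12.
Qed.

(** Addition in [F] is not that of the algebra, and [<< Some 1 >>] is not its unit. Elements
    representing the same [x] nevertheless agree, after any multiplication, under all extended
    additive functions. *)
Definition represents b x := forall h, additive_fun h ->
  forall z, extend h (b * z) = extend (fun y => h (x * y)) z.

Lemma additive_mulr h x : additive_fun h -> additive_fun (fun y => h (x * y)).
Proof. by move=> hD y z; rewrite mulrDr hD. Qed.

Lemma representsU u : represents << u >> (unital_val u).
Proof.
move=> h hD; apply: (scalar_malg_ext (l1 := shift << u >> (extend h))) => v.
by rewrite shiftE malgU_mul /= !extendU unital_valM.
Qed.

Lemma representsM b1 b2 x1 x2 :
  represents b1 x1 -> represents b2 x2 -> represents (b1 * b2) (x1 * x2).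
Proof.
move=> r1 r2 h hD z; rewrite -mulrA r1 // r2; last exact: additive_mulr.
by congr (extend _ z); apply/funext => y; rewrite mulrA.
Qed.

Lemma represents1 : represents 1 1.
Proof.
move=> h hD z; rewrite mul1r.
by congr (extend _ z); apply/funext => y; rewrite mul1r.
Qed.

Lemma representsX b x k : represents b x -> represents (b ^+ k) (x ^+ k).
Proof.
move=> rb; elim: k => [|k IH]; first exact: represents1.
by rewrite !exprS; apply: representsM.
Qed.

Lemma representsD b1 b2 x1 x2 :
  represents b1 x1 -> represents b2 x2 -> represents (b1 + b2) (x1 + x2).
Proof.
move=> r1 r2 h hD z; rewrite mulrDl linearD /= r1 // r2 //.
have linE : linear_for *%R
    (fun z : B => extend (fun y => h (x1 * y)) z + extend (fun y => h (x2 * y)) z).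
  by move=> c u v; rewrite !linearP /= mulrDr addrACA.
pose l : {scalar B} := HB.pack (fun z : B =>
    extend (fun y => h (x1 * y)) z + extend (fun y => h (x2 * y)) z)
  (GRing.isLinear.Build K B K *%R _ linE).
rewrite -[LHS]/(l z); apply: scalar_malg_ext => u.
by rewrite -[LHS]/(_ + _) /= !extendU mulrDl hD.
Qed.

Lemma represents0 : represents 0 0.
Proof.
move=> h hD z; rewrite mul0r linear0.
have h0 : h 0 = 0 by apply: (addrI (h 0)); rewrite -hD !addr0.
pose l : {scalar B} := shift 0 (extend h).
have lE b : l b = 0 by rewrite /l shiftE mul0r linear0.
rewrite -[LHS](lE z); apply: scalar_malg_ext => u.
by rewrite lE /= extendU mul0r h0.
Qed.

Lemma represents_nat b x k : represents b x -> represents (b *+ k) (x *+ k).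
Proof.
move=> rb; elim: k => [|k IH]; first exact: represents0.
by rewrite !mulrS; apply: representsD.
Qed.

Lemma represents_val h b x : additive_fun h -> represents b x -> extend h b = h x.
Proof. by move=> hD rb; rewrite -[b]mulr1 rb // extendU /= mulr1. Qed.

Section Identity.
Variables (n : nat) (p q : 'I_n -> nat) (f g : 'I_n -> F -> K).
Hypotheses (fD : forall i, additive_fun (f i)) (gD : forall i, additive_fun (g i))
  (fgE : forall x, \sum_(i < n) f i (x ^+ p i) * g i x ^+ q i = 0).

(* The left side is a polynomial in the coefficients of b which vanishes at the
   natural numbers, where b represents an element of F. *)
Lemma extended_identity b :
  \sum_(i < n) extend (f i) (b ^+ p i) * extend (g i) b ^+ q i = 0.
Proof.
(* The coefficients are freed one at a time: a natural value of the current one is absorbed into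
   [b0], which must represent an element of [F]. *)
suff E (s : seq (K * unital F)) b0 x0 : represents b0 x0 ->
    let b := b0 + \sum_(cu <- s) cu.1 *: << cu.2 >> in
    \sum_(i < n) extend (f i) (b ^+ p i) * extend (g i) b ^+ q i = 0.
  have := E [seq (b@_u, u) | u <- msupp b] 0 0 represents0.
  rewrite big_map add0r /= (_ : \sum_(u <- _) _ = b) // [RHS]monalgE.
  by apply: eq_bigr => u _; apply/esym/malgU_scale.
elim: s b0 x0 => [|[c u] s IHs] b0 x0 r0 /=.
  rewrite big_nil addr0 -[RHS](fgE x0); apply: eq_bigr => i _.
  by rewrite (represents_val (gD i) r0) (represents_val (fD i) (representsX _ r0)).
pose b1 := b0 + \sum_(cu <- s) cu.1 *: << cu.2 >>.
pose P : {poly K} := \sum_(i < n) power_line (extend (f i)) (p i) b1 << u >> *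
  affine_line (extend (g i)) b1 << u >> ^+ q i.
have PE t : P.[t] = \sum_(i < n) extend (f i) ((b1 + t *: << u >>) ^+ p i) *
    extend (g i) (b1 + t *: << u >>) ^+ q i.
  rewrite horner_sum; apply: eq_bigr => i _.
  by rewrite hornerM horner_exp horner_power_line horner_affine_line.
have P0 : P = 0.
  apply: poly_eq0_nat => k; rewrite PE /b1 addrAC.
  apply: (IHs _ (x0 + unital_val u *+ k)); rewrite scaler_nat.
  exact/(representsD r0)/represents_nat/representsU.
have -> : b0 + \sum_(cu <- (c, u) :: s) cu.1 *: << cu.2 >> = b1 + c *: << u >>.
  by rewrite big_cons /= addrCA addrC.
by rewrite -PE P0 horner0.
Qed.

End Identity.
End Extension.

Theorem additive_solutions_gen_exp_poly (K : numClosedFieldType) (F : fieldType)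
    (n N : nat) (p q : 'I_n -> nat) (f g : 'I_n -> F -> K) :
  (0 < n)%N -> (forall i, (0 < p i)%N) -> (forall i, (0 < q i)%N) ->
  (forall i j : 'I_n, (i < j)%N -> (p i < p j)%N) ->
  (forall i, (p i + q i)%N = N) ->
  (forall i j : 'I_n, i != j -> (p i < q j)%N) -> (forall i, (p i <= q i)%N) ->
  (forall i, additive_fun (f i)) -> (forall i, additive_fun (g i)) ->
  (forall i, exists x, f i x != 0) -> (forall i, exists x, g i x != 0) ->
  (forall x, \sum_(i < n) f i (x ^+ p i) * g i x ^+ q i = 0) ->
  forall i, gen_exp_poly n.-1 (fun x : mul_group F => f i (val x)) /\
            gen_exp_poly n.-1 (fun x : mul_group F => g i (val x)).
Proof.
move=> n0 p0 q0 p_incr pqN p_lt_q p_le_q fD gD fn0 gn0 fgE.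
pose X (x : mul_group F) : {malg K[unital F]} := << Some (val x) >>.
have repX x : represents (X x) (val x) by apply: representsU.
have JX b1 b2 x : represents b1 x -> represents b2 x ->
    annihilator_all (fun i => extend (f i)) (fun i => extend (g i)) (b1 - b2).
  by move=> r1 r2 i z; rewrite mulrBl !linearB /= !r1 ?r2 ?subrr.
have E h : (fun x : mul_group F => h (val x)) = (fun x => extend h (X x)).
  by apply/funext => x; rewrite extendU.
move=> i; rewrite !E.
apply: (algebra_gen_exp_poly (f := fun i => extend (f i)) (g := fun i => extend (g i))
  n0 p0 q0 p_incr pqN p_lt_q p_le_q) => [j|j|||a b].
- by have [x fx] := fn0 j; exists << Some x >>; rewrite /= extendU.
- by have [x gx] := gn0 j; exists << Some x >>; rewrite /= extendU.
- exact: extended_identity.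
- by apply: (JX _ _ 1); [apply: repX | apply: represents1].
by apply: (JX _ _ (val a * val b)); [apply: repX | apply: representsM].
Qed.

Theorem theorem8 (R : realType) (S : {pred R[i]}) (F : subFieldType S)
    (n N : nat) (p q : 'I_n -> nat) (f g : 'I_n -> F -> R[i]) :
  (0 < n)%N -> (0 < N)%N ->
  (forall i, (0 < p i)%N) -> (forall i, (0 < q i)%N) ->
  (forall i j : 'I_n, (i < j)%N -> (p i < p j)%N) ->
  (forall i, (p i + q i)%N = N) ->
  (forall i j : 'I_n, i <> j -> p i <> q j) ->
  (forall i, N%:R / 2 <= (q i)%:R :> rat) ->
  (forall i (x y : F), f i (x + y) = f i x + f i y) ->
  (forall i (x y : F), g i (x + y) = g i x + g i y) ->
  (forall i, exists x : F, f i x <> 0) ->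
  (forall i, exists x : F, g i x <> 0) ->
  (forall x : F, \sum_(i < n) f i (x ^+ p i) * g i x ^+ q i = 0) ->
  forall i : 'I_n,
    gen_exp_poly n.-1 (fun x : mul_group F => f i (val x)) /\
    gen_exp_poly n.-1 (fun x : mul_group F => g i (val x)).
Proof.
move=> n0 _ p0 q0 p_incr pqN pq_neq q_ge fD gD fn0 gn0 fgE.
(* Hence [p i <= N/2 <= q j] for all [i], [j], strictly for [i != j] because [p i] and [q j]
   differ. *)
have q_half i : (N <= q i * 2)%N.
  by have := q_ge i; rewrite ler_pdivrMr ?ltr0n // -natrM ler_nat.
have p_le_q i : (p i <= q i)%N by have := q_half i; have := pqN i; lia.
apply: (@additive_solutions_gen_exp_poly _ _ n N p q) => //.
- move=> i j /eqP ij; have := pq_neq i j ij; have := q_half i; have := q_half j.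
  by have := pqN i; have := pqN j; lia.
- by move=> i; have [x /eqP fx] := fn0 i; exists x.
- by move=> i; have [x /eqP gx] := gn0 i; exists x.
Qed.
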